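(* Let $A$ be a bounded linear operator from a right quaternionic Banach space $\mathcal P$ into itself, and let $G$ be a bounded linear operator from $\mathcal P$ into $\mathcal Q$, where $\mathcal Q$ is a two-sided quaternionic Banach space. The slice hyperholomorphic extension of the function $x\mapsto G(I-xA)^{-1}$, $1/x\in\rho_S(A)\cap\mathbb R$, is $$(G-\bar p\,GA)\big(I-2\mathrm{Re}(p)\,A+|p|^2A^2\big)^{-1}.$$
   Context: $\mathbb H$: quaternions; $\mathbb S$: purely imaginary unit quaternions; $\mathbb C_I=\mathbb R+I\mathbb R$. The $S$-spectrum $\sigma_S(A)$ is the set of $p\in\mathbb H$ such that $A^2-2\mathrm{Re}(p)A+|p|^2I$ is not invertible, and $\rho_S(A)=\mathbb H\setminus\sigma_S(A)$. For $T:\mathcal P\to\mathcal Q$ and $p\in\mathbb H$, $(pT)u=p(Tu)$. A function $f$ with values in bounded right linear operators $\mathcal P\to\mathcal Q$ is slice hyperholomorphic if it is real differentiable and $(\partial_x+I\partial_y)f(x+Iy)=0$ on each complex plane $\mathbb C_I$, $I\in\mathbb S$. The slice hyperholomorphic extension of a function given for real $x$ is the slice hyperholomorphic function of $p$ coinciding with it for $p=x$ real; here $p$ ranges over the quaternions for which $I-2\mathrm{Re}(p)A+|p|^2A^2$ is invertible. *)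

(* Defs.v *)
From HB Require Import structures.
From mathcomp Require Import all_boot all_order all_algebra.
From mathcomp Require Import ring lra.
From mathcomp Require Import boolp classical_sets reals.
From mathcomp Require Import topology normedtype derive.

Set Implicit Arguments.
Unset Strict Implicit.
Unset Printing Implicit Defensive.

Import Order.TTheory GRing.Theory Num.Theory.
Import numFieldNormedType.Exports.

Local Open Scope classical_set_scope.
Local Open Scope ring_scope.

(* [Quat a b c d] is a + b i + c j + d k. *)
Record quat (R : realType) := Quat { qre : R; qi : R; qj : R; qk : R }.

Section Quaternions.
Context {R : realType}.
Implicit Types p q r : quat R.

Lemma quat_eq p q :
  qre p = qre q -> qi p = qi q -> qj p = qj q -> qk p = qk q -> p = q.
Proof. by case: p q => [a b c d] [a' b' c' d'] /= -> -> -> ->. Qed.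

HB.instance Definition _ := gen_eqMixin (quat R).
HB.instance Definition _ := gen_choiceMixin (quat R).

Definition qreal (x : R) : quat R := Quat x 0 0 0.

Definition qadd p q :=
  Quat (qre p + qre q) (qi p + qi q) (qj p + qj q) (qk p + qk q).
Definition qopp p := Quat (- qre p) (- qi p) (- qj p) (- qk p).
Definition qscale (x : R) p := Quat (x * qre p) (x * qi p) (x * qj p) (x * qk p).
Definition qmul p q := Quat
  (qre p * qre q - qi p * qi q - qj p * qj q - qk p * qk q)
  (qre p * qi q + qi p * qre q + qj p * qk q - qk p * qj q)
  (qre p * qj q - qi p * qk q + qj p * qre q + qk p * qi q)
  (qre p * qk q + qi p * qj q - qj p * qi q + qk p * qre q).
Definition qconj p := Quat (qre p) (- qi p) (- qj p) (- qk p).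
Definition qnorm p :=
  Num.sqrt (qre p ^+ 2 + qi p ^+ 2 + qj p ^+ 2 + qk p ^+ 2).

Fact qaddA : associative qadd.
Proof. by move=> p q r; apply: quat_eq => /=; ring. Qed.
Fact qaddC : commutative qadd.
Proof. by move=> p q; apply: quat_eq => /=; ring. Qed.
Fact qadd0 : left_id (qreal 0) qadd.
Proof. by move=> p; apply: quat_eq => /=; ring. Qed.
Fact qaddN : left_inverse (qreal 0) qopp qadd.
Proof. by move=> p; apply: quat_eq => /=; ring. Qed.

HB.instance Definition _ := GRing.isZmodule.Build (quat R) qaddA qaddC qadd0 qaddN.

Fact qmulA : associative qmul.
Proof. by move=> p q r; apply: quat_eq => /=; ring. Qed.
Fact qmul1l : left_id (qreal 1) qmul.
Proof. by move=> p; apply: quat_eq => /=; ring. Qed.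
Fact qmul1r : right_id (qreal 1) qmul.
Proof. by move=> p; apply: quat_eq => /=; ring. Qed.
Fact qmulDl : left_distributive qmul +%R.
Proof. by move=> p q r; apply: quat_eq => /=; ring. Qed.
Fact qmulDr : right_distributive qmul +%R.
Proof. by move=> p q r; apply: quat_eq => /=; ring. Qed.
Fact quat1_neq0 : qreal 1 != 0.
Proof. by apply/eqP => /(congr1 (@qre R))/eqP; rewrite oner_eq0. Qed.

HB.instance Definition _ := GRing.Zmodule_isNzRing.Build (quat R)
  qmulA qmul1l qmul1r qmulDl qmulDr quat1_neq0.

Fact qscaleA x y p : qscale x (qscale y p) = qscale (x * y) p.
Proof. by apply: quat_eq => /=; ring. Qed.
Fact qscale1 : left_id 1 qscale.
Proof. by move=> p; apply: quat_eq => /=; ring. Qed.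
Fact qscaleDr : right_distributive qscale +%R.
Proof. by move=> x p q; apply: quat_eq => /=; ring. Qed.
Fact qscaleDl p : {morph qscale^~ p : x y / x + y}.
Proof. by move=> x y; apply: quat_eq => /=; ring. Qed.

HB.instance Definition _ := GRing.Zmodule_isLmodule.Build R (quat R)
  qscaleA qscale1 qscaleDr qscaleDl.

Fact qnormD p q : qnorm (p + q) <= qnorm p + qnorm q.
Proof.
case: p q => [a b c d] [a' b' c' d']; rewrite /qnorm /=.
set s := a ^+ 2 + _ + _ + _; set t := a' ^+ 2 + _ + _ + _.
have s0 : 0 <= s by rewrite /s !addr_ge0 ?sqr_ge0.
have t0 : 0 <= t by rewrite /t !addr_ge0 ?sqr_ge0.
rewrite -(@ler_pXn2r _ 2%N) ?nnegrE ?addr_ge0 ?sqrtr_ge0//.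
set w := (X in Num.sqrt X ^+ 2 <= _).
have w0 : 0 <= w by rewrite /w !addr_ge0 ?sqr_ge0.
have Ew : Num.sqrt w ^+ 2 = w by apply: sqr_sqrtr.
have Es : Num.sqrt s ^+ 2 = s by apply: sqr_sqrtr.
have Et : Num.sqrt t ^+ 2 = t by apply: sqr_sqrtr.
rewrite {}Ew sqrrD {}Es {}Et -sqrtrM//.
have CS : a * a' + b * b' + c * c' + d * d' <= Num.sqrt (s * t).
  apply: le_trans (ler_norm _) _.
  rewrite -sqrtr_sqr ler_sqrt ?mulr_ge0// -subr_ge0.
  rewrite (_ : _ - _ = (a * b' - b * a') ^+ 2 + (a * c' - c * a') ^+ 2
    + (a * d' - d * a') ^+ 2 + (b * c' - c * b') ^+ 2
    + (b * d' - d * b') ^+ 2 + (c * d' - d * c') ^+ 2); last by rewrite /s /t; ring.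
  by rewrite !addr_ge0 ?sqr_ge0.
rewrite /w /s /t in CS *; nra.
Qed.

Fact qnormZ x p : qnorm (x *: p) = `|x| * qnorm p.
Proof.
rewrite /qnorm /= -sqrtr_sqr -sqrtrM ?sqr_ge0//.
by congr Num.sqrt; ring.
Qed.

Fact qnorm_eq0 p : qnorm p = 0 -> p = 0.
Proof.
case: p => [a b c d]; rewrite /qnorm /= => /eqP; rewrite sqrtr_eq0 => h.
have ha := sqr_ge0 a; have hb := sqr_ge0 b.
have hc := sqr_ge0 c; have hd := sqr_ge0 d.
by apply: quat_eq => /=; apply/eqP; rewrite -sqrf_eq0 eq_le; apply/andP; split;
  lra.
Qed.

HB.instance Definition _ :=
  Lmodule_isNormed.Build R (quat R) qnormD qnormZ qnorm_eq0.

Lemma quat_normE p : `|p| = qnorm p.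
Proof. by []. Qed.

Definition imag_unit : set (quat R) := [set I | qre I = 0 /\ `|I| = 1].

Definition slice_pt (I : quat R) (x y : R) : quat R := qreal x + I * qreal y.

Definition slice_plane (I : quat R) : set (quat R) :=
  [set p | exists x y, p = slice_pt I x y].

Definition real_axis : set (quat R) := range qreal.

End Quaternions.

(* By [qrscale_real], the underlying real Banach space is the restriction of
   scalars of the quaternionic one. *)
HB.mixin Record CompleteNormedModule_isRightQuatBanach (R : realType) P
    & CompleteNormedModule R P := {
  qrscale : P -> quat R -> P;
  qrscaleDl : forall u v p, qrscale (u + v) p = qrscale u p + qrscale v p;
  qrscaleDr : forall u p q, qrscale u (p + q) = qrscale u p + qrscale u q;
  qrscaleA : forall u p q, qrscale u (p * q) = qrscale (qrscale u p) q;
  qrscale_real : forall u (x : R), qrscale u (qreal x) = x *: u;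
  qrscale_norm : forall u p, `|qrscale u p| = `|u| * `|p|
}.

#[short(type="rightQuatBanachType")]
HB.structure Definition RightQuatBanach (R : realType) :=
  {P of CompleteNormedModule R P & CompleteNormedModule_isRightQuatBanach R P}.

HB.mixin Record RightQuatBanach_isTwoSided (R : realType) Q
    & RightQuatBanach R Q := {
  qlscale : quat R -> Q -> Q;
  qlscaleDl : forall p q u, qlscale (p + q) u = qlscale p u + qlscale q u;
  qlscaleDr : forall p u v, qlscale p (u + v) = qlscale p u + qlscale p v;
  qlscaleA : forall p q u, qlscale (p * q) u = qlscale p (qlscale q u);
  qlscale_real : forall (x : R) u, qlscale (qreal x) u = x *: u;
  qlscale_norm : forall p u, `|qlscale p u| = `|p| * `|u|;
  qlrscaleA : forall p u q, qrscale (qlscale p u) q = qlscale p (qrscale u q)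
}.

#[short(type="twoSidedQuatBanachType")]
HB.structure Definition TwoSidedQuatBanach (R : realType) :=
  {Q of RightQuatBanach R Q & RightQuatBanach_isTwoSided R Q}.

Record qbop (R : realType) (P Q : rightQuatBanachType R) := QBop {
  qbop_fun :> P -> Q;
  qbopD : forall u v, qbop_fun (u + v) = qbop_fun u + qbop_fun v;
  qbopZr : forall u p, qbop_fun (qrscale u p) = qrscale (qbop_fun u) p;
  qbop_bounded : exists M : R, forall u, `|qbop_fun u| <= M * `|u|
}.

Section BoundedOperators.
Context {R : realType} {P Q : rightQuatBanachType R}.
Implicit Types S T : qbop P Q.

Lemma qbop_eq S T : (forall u, S u = T u) -> S = T.
Proof.
case: S T => [f fD fZ fM] [g gD gZ gM] /= /funext fg; subst g.
by rewrite (Prop_irrelevance fD gD) (Prop_irrelevance fZ gZ)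
  (Prop_irrelevance fM gM).
Qed.

HB.instance Definition _ := gen_eqMixin (qbop P Q).
HB.instance Definition _ := gen_choiceMixin (qbop P Q).

Lemma qbop_scale T x u : T (x *: u) = x *: T u.
Proof. by rewrite -!qrscale_real qbopZr. Qed.

Lemma qbop0 T : T 0 = 0.
Proof. by rewrite -(scale0r 0) qbop_scale scale0r. Qed.

Lemma qrscale0l (p : quat R) : qrscale (0 : Q) p = 0.
Proof. by apply/eqP; rewrite -normr_eq0 qrscale_norm normr0 mul0r. Qed.

Lemma qrscaleZl x (u : Q) p : qrscale (x *: u) p = x *: qrscale u p.
Proof.
by rewrite -!qrscale_real -!qrscaleA; congr qrscale; apply: quat_eq => /=; ring.
Qed.

Fact qbop_zeroZr (u : P) (p : quat R) : (0 : Q) = qrscale 0 p.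
Proof. by rewrite qrscale0l. Qed.
Fact qbop_zero_bounded : exists M : R, forall u : P, `|0 : Q| <= M * `|u|.
Proof. by exists 0 => u; rewrite mul0r normr0. Qed.
Definition qbop_zero : qbop P Q :=
  QBop (fun _ _ => esym (addr0 0)) qbop_zeroZr qbop_zero_bounded.

Fact qbop_addD S T u v : S (u + v) + T (u + v) = (S u + T u) + (S v + T v).
Proof. by rewrite !qbopD addrACA. Qed.
Fact qbop_addZr S T u p :
  S (qrscale u p) + T (qrscale u p) = qrscale (S u + T u) p.
Proof. by rewrite !qbopZr qrscaleDl. Qed.
Fact qbop_add_bounded S T : exists M : R, forall u, `|S u + T u| <= M * `|u|.
Proof.
have [M SM] := qbop_bounded S; have [N TN] := qbop_bounded T.
by exists (M + N) => u; rewrite mulrDl (le_trans (ler_normD _ _))// lerD.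
Qed.
Definition qbop_add S T : qbop P Q :=
  QBop (qbop_addD S T) (qbop_addZr S T) (qbop_add_bounded S T).

Fact qbop_scalerD x T u v : x *: T (u + v) = x *: T u + x *: T v.
Proof. by rewrite qbopD scalerDr. Qed.
Fact qbop_scalerZr x T u p : x *: T (qrscale u p) = qrscale (x *: T u) p.
Proof. by rewrite qbopZr qrscaleZl. Qed.
Fact qbop_scaler_bounded x T : exists M : R, forall u, `|x *: T u| <= M * `|u|.
Proof.
have [M TM] := qbop_bounded T.
by exists (`|x| * M) => u; rewrite normrZ -mulrA ler_wpM2l.
Qed.
Definition qbop_scaler (x : R) T : qbop P Q :=
  QBop (qbop_scalerD x T) (qbop_scalerZr x T) (qbop_scaler_bounded x T).

Definition qbop_opp T := qbop_scaler (-1) T.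

Fact qbop_addA : associative qbop_add.
Proof. by move=> S T U; apply: qbop_eq => u /=; rewrite addrA. Qed.
Fact qbop_addC : commutative qbop_add.
Proof. by move=> S T; apply: qbop_eq => u /=; rewrite addrC. Qed.
Fact qbop_add0 : left_id qbop_zero qbop_add.
Proof. by move=> S; apply: qbop_eq => u /=; rewrite add0r. Qed.
Fact qbop_addN : left_inverse qbop_zero qbop_opp qbop_add.
Proof. by move=> S; apply: qbop_eq => u /=; rewrite scaleN1r addNr. Qed.

HB.instance Definition _ := GRing.isZmodule.Build (qbop P Q)
  qbop_addA qbop_addC qbop_add0 qbop_addN.

Fact qbop_scalerA x y T : qbop_scaler x (qbop_scaler y T) = qbop_scaler (x * y) T.
Proof. by apply: qbop_eq => u /=; rewrite scalerA. Qed.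
Fact qbop_scaler1 : left_id 1 qbop_scaler.
Proof. by move=> T; apply: qbop_eq => u /=; rewrite scale1r. Qed.
Fact qbop_scalerDr : right_distributive qbop_scaler +%R.
Proof. by move=> x S T; apply: qbop_eq => u /=; rewrite scalerDr. Qed.
Fact qbop_scalerDl T : {morph qbop_scaler^~ T : x y / x + y}.
Proof. by move=> x y; apply: qbop_eq => u /=; rewrite scalerDl. Qed.

HB.instance Definition _ := GRing.Zmodule_isLmodule.Build R (qbop P Q)
  qbop_scalerA qbop_scaler1 qbop_scalerDr qbop_scalerDl.

Definition opnorm T : R := sup [set `|T u| | u in [set u : P | `|u| <= 1]].

Lemma opnorm_has_sup T : has_sup [set `|T u| | u in [set u : P | `|u| <= 1]].
Proof.
split; first by exists `|T 0|, 0 => //=; rewrite normr0.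
have [M TM] := qbop_bounded T; exists `|M| => _ [u /= u1 <-].
apply: le_trans (TM u) _; apply: (@le_trans _ _ (`|M| * `|u|)).
  by rewrite ler_wpM2r// ler_norm.
by rewrite ler_piMr.
Qed.

Lemma opnorm_ub T u : `|u| <= 1 -> `|T u| <= opnorm T.
Proof.
by move=> u1; apply: ub_le_sup; [have [] := opnorm_has_sup T | exists u].
Qed.

Lemma opnorm_le T (M : R) : (forall u, `|u| <= 1 -> `|T u| <= M) -> opnorm T <= M.
Proof.
move=> TM; apply: ge_sup; first by have [] := opnorm_has_sup T.
by move=> _ [u /= u1 <-]; exact: TM.
Qed.

Lemma opnorm_ge0 T : 0 <= opnorm T.
Proof. by apply: le_trans (opnorm_ub T (u := 0) _); rewrite ?normr0. Qed.

Lemma qbop_norm_le T u : `|T u| <= opnorm T * `|u|.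
Proof.
have [->|u0] := eqVneq u 0; first by rewrite qbop0 !normr0 mulr0.
have nu0 : 0 < `|u| by rewrite normr_gt0.
have : `|T (`|u|^-1 *: u)| <= opnorm T.
  by apply: opnorm_ub; rewrite normrZ normfV normr_id mulVf// gt_eqF.
by rewrite qbop_scale normrZ normfV normr_id mulrC ler_pdivrMr.
Qed.

Fact opnormD S T : opnorm (S + T) <= opnorm S + opnorm T.
Proof.
apply: opnorm_le => u u1; apply: le_trans (ler_normD _ _) _.
by rewrite lerD// opnorm_ub.
Qed.

Fact opnormZ x T : opnorm (x *: T) = `|x| * opnorm T.
Proof.
have le_opnormZ y U : opnorm (y *: U) <= `|y| * opnorm U.
  by apply: opnorm_le => u u1; rewrite /= normrZ ler_wpM2l// opnorm_ub.
apply/eqP; rewrite eq_le le_opnormZ /=.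
have [->|x0] := eqVneq x 0; first by rewrite normr0 mul0r opnorm_ge0.
have := le_opnormZ x^-1 (x *: T).
by rewrite scalerA mulVf// scale1r normfV mulrC ler_pdivlMr ?normr_gt0// mulrC.
Qed.

Fact opnorm_eq0 T : opnorm T = 0 -> T = 0.
Proof.
move=> T0; apply: qbop_eq => u /=; apply/eqP; rewrite -normr_le0.
by apply: le_trans (qbop_norm_le T u) _; rewrite T0 mul0r.
Qed.

HB.instance Definition _ :=
  Lmodule_isNormed.Build R (qbop P Q) opnormD opnormZ opnorm_eq0.

Lemma qbop_normE T : `|T| = opnorm T.
Proof. by []. Qed.

End BoundedOperators.

Fact qbop_id_bounded (R : realType) (P : rightQuatBanachType R) :
  exists M : R, forall u : P, `|u| <= M * `|u|.
Proof. by exists 1 => u; rewrite mul1r. Qed.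

Definition qbop_id (R : realType) (P : rightQuatBanachType R) : qbop P P :=
  @QBop R P P id (fun _ _ => erefl) (fun _ _ => erefl) (qbop_id_bounded P).

Section Composition.
Context {R : realType} {P1 P2 P3 : rightQuatBanachType R}.
Variables (S : qbop P2 P3) (T : qbop P1 P2).

Fact qbop_compD u v : S (T (u + v)) = S (T u) + S (T v).
Proof. by rewrite !qbopD. Qed.
Fact qbop_compZr u p : S (T (qrscale u p)) = qrscale (S (T u)) p.
Proof. by rewrite !qbopZr. Qed.
Fact qbop_comp_bounded : exists M : R, forall u, `|S (T u)| <= M * `|u|.
Proof.
exists (opnorm S * opnorm T) => u; apply: le_trans (qbop_norm_le _ _) _.
by rewrite -mulrA ler_wpM2l ?opnorm_ge0// qbop_norm_le.
Qed.
Definition qbop_comp : qbop P1 P3 := QBop qbop_compD qbop_compZr qbop_comp_bounded.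

End Composition.

Notation "S \comp T" := (qbop_comp S T)
  (at level 40, left associativity) : ring_scope.

Section LeftScaling.
Context {R : realType} {P : rightQuatBanachType R} {Q : twoSidedQuatBanachType R}.
Variables (p : quat R) (T : qbop P Q).

Fact qbop_lscaleD u v : qlscale p (T (u + v)) = qlscale p (T u) + qlscale p (T v).
Proof. by rewrite qbopD qlscaleDr. Qed.
Fact qbop_lscaleZr u q :
  qlscale p (T (qrscale u q)) = qrscale (qlscale p (T u)) q.
Proof. by rewrite qbopZr qlrscaleA. Qed.
Fact qbop_lscale_bounded : exists M : R, forall u, `|qlscale p (T u)| <= M * `|u|.
Proof.
exists (`|p| * opnorm T) => u.
by rewrite qlscale_norm -mulrA ler_wpM2l// qbop_norm_le.
Qed.

Definition qbop_lscale : qbop P Q :=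
  QBop qbop_lscaleD qbop_lscaleZr qbop_lscale_bounded.

End LeftScaling.

Notation "p \ql T" := (qbop_lscale p T)
  (at level 40, left associativity) : ring_scope.

Section Inverse.
Context {R : realType} {P : rightQuatBanachType R}.
Implicit Types S T : qbop P P.

Definition is_qbop_inv T S := S \comp T = qbop_id P /\ T \comp S = qbop_id P.

Definition qbop_invertible T := exists S, is_qbop_inv T S.

(* Junk value 0 when [T] is not invertible. *)
Definition qbop_inv T : qbop P P := xget 0 [set S | is_qbop_inv T S].

End Inverse.

Section SSpectrum.
Context {R : realType} {P : rightQuatBanachType R}.
Implicit Type A : qbop P P.

Definition S_spectrum A : set (quat R) :=
  [set p | ~ qbop_invertible
             (A \comp A - (2 * qre p) *: A + (`|p| ^+ 2) *: qbop_id P)].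

Definition S_resolvent_set A : set (quat R) := ~` S_spectrum A.

Definition qpencil A (p : quat R) : qbop P P :=
  qbop_id P - (2 * qre p) *: A + (`|p| ^+ 2) *: (A \comp A).

End SSpectrum.

Section SliceHyperholomorphic.
Context {R : realType} {P : rightQuatBanachType R}
        {Q : twoSidedQuatBanachType R}.

(* (d/dx + I d/dy) f at x + Iy *)
Definition slice_CR (f : quat R -> qbop P Q) (I : quat R) (x y : R) : qbop P Q :=
  derive1 (fun s : R => f (slice_pt I s y)) x +
  I \ql derive1 (fun t : R => f (slice_pt I x t)) y.

(* Values of [f] outside the open set [U] are irrelevant. *)
Definition slice_hyperholomorphic (U : set (quat R)) (f : quat R -> qbop P Q) :=
  [/\ open U,
      forall p, U p -> differentiable f p
    & forall I x y, imag_unit I -> U (slice_pt I x y) -> slice_CR f I x y = 0].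

Definition is_slice_extension (D : set R) (g : R -> qbop P Q)
    (U : set (quat R)) (f : quat R -> qbop P Q) :=
  slice_hyperholomorphic U f /\
  forall x, D x -> U (qreal x) -> f (qreal x) = g x.

End SliceHyperholomorphic.

(* s-domains: on these, a slice hyperholomorphic function is determined by its
   values at the real points. *)
Definition slice_domain (R : realType) (U : set (quat R)) :=
  [/\ open U, U `&` real_axis !=set0
    & forall I, imag_unit I -> connected (U `&` slice_plane I)].

(* [f], defined on [U], is the slice hyperholomorphic extension of [g]. An open
   set may have components that do not meet the real axis, where an extension is
   not determined by [g], hence uniqueness is required on the s-domains
   contained in [U]. *)
Definition is_the_slice_extension (R : realType) (P : rightQuatBanachType R)
    (Q : twoSidedQuatBanachType R) (D : set R) (g : R -> qbop P Q)
    (U : set (quat R)) (f : quat R -> qbop P Q) :=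
  [/\ forall x, D x -> U (qreal x),
      is_slice_extension D g U f
    & forall (V : set (quat R)) (h : quat R -> qbop P Q),
        slice_domain V -> V `<=` U -> is_slice_extension D g V h ->
        forall p, V p -> h p = f p].

(* Main.v *)
Require Import Defs.
From HB Require Import structures.
From mathcomp Require Import all_boot all_order all_algebra.
From mathcomp Require Import ring lra complex.
From mathcomp Require Import boolp classical_sets functions reals interval_inference.
From mathcomp Require Import topology normedtype landau derive sequences.

Set Implicit Arguments.
Unset Strict Implicit.
Unset Printing Implicit Defensive.

Import Order.TTheory GRing.Theory Num.Theory ComplexField.Normc.
Import numFieldNormedType.Exports.

Local Open Scope classical_set_scope.
Local Open Scope ring_scope.

Local Notation Re := complex.Re.
Local Notation Im := complex.Im.

(** Existence is a computation.  Let L(p) = I - 2 Re(p) A + |p|^2 A^2.  For real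
    x other than 0,
      A^2 - (2/x) A + x^-2 I = x^-2 (I - x A)^2 = x^-2 L(x),
    so 1/x lies in the resolvent set exactly when L(x) is invertible, and then
    (G - x G A) (I - x A)^-2 = G (I - x A)^-1.  The map p |-> L(p)^-1
    is defined on an open set and differentiable, because inversion of
    operators is (Neumann series).  Write N(p) = G - conj(p) G A and, on the
    plane of I, p = x + I y.  As A commutes with L, the Cauchy-Riemann operator
    applied to N L^-1 is
      - (N (d_x L) + I N (d_y L) + 2 G A L) L^-2,
    whose bracket vanishes because p N A^2 = p G A^2 - |p|^2 G A^3 and
    p + conj(p) = 2 x ([dqresolvent_CR]).

    Uniqueness is an identity theorem.  The restriction to a slice of the
    difference of two extensions is complex differentiable, for the complex
    structure on operators given by left multiplication by I, and it vanishes
    at the real points.  No continuity of the derivative is assumed, so the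
    identity theorem has to start from a Goursat argument, given here with
    finite sums in place of integrals.

    - The integral over the boundary of a square is replaced by the midpoint
      sums over 2^n equal steps per side.  These are exactly additive when
      the square is cut into four ([contour_sum_split]), exactly zero on affine
      functions ([contour_sum_affine]) and bounded by perimeter times supremum.
      Bisection then shows that the sums of a complex differentiable function
      tend to 0 as n grows, even if at one exceptional point the function is only
      bounded nearby ([goursat]).
    - Applied to (F(w) - F(a)) / (w - a), this gives |F(a)| <= 2 M for a the
      centre of a square and M a bound of |F| away from a ([cauchy_estimate]).
    - If F vanishes near c, then F(w) / (w - c)^n is complex differentiable for
      every n, and the estimate at a point a closer to c than the boundary of a
      square around a is, forces F(a) = 0 as n grows ([unique_continuation]).
    - A function vanishing on a real interval has derivative 0 there, so cutting
      it off to 0 in one half plane keeps it complex differentiable; the cut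
      function vanishes on a disc, hence near the interval
      ([vanish_near_real]).

    Connectedness of the slice of an s-domain finishes the proof
    ([slice_identity]). *)

(** * Complex numbers in coordinates *)

Section ComplexCoordinates.
Context {R : realType}.
Implicit Types (z w : R[i]) (x : R).

Lemma complex_ext z w : Re z = Re w -> Im z = Im w -> z = w.
Proof. by case: z w => [a b] [c d] /= -> ->. Qed.

Lemma Re_add z w : Re (z + w) = Re z + Re w.
Proof. by case: z w => [a b] [c d]. Qed.
Lemma Im_add z w : Im (z + w) = Im z + Im w.
Proof. by case: z w => [a b] [c d]. Qed.
Lemma Re_opp z : Re (- z) = - Re z.
Proof. by case: z. Qed.
Lemma Im_opp z : Im (- z) = - Im z.
Proof. by case: z. Qed.
Lemma Re_mul z w : Re (z * w) =
  Re z * Re w - Im z * Im w.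
Proof. by case: z w => [a b] [c d]. Qed.
Lemma Im_mul z w : Im (z * w) =
  Re z * Im w + Im z * Re w.
Proof. by case: z w => [a b] [c d]. Qed.
Lemma Re_inv z : Re z^-1 =
  Re z / (Re z ^+ 2 + Im z ^+ 2).
Proof. by case: z. Qed.
Lemma Im_inv z : Im z^-1 =
  - (Im z / (Re z ^+ 2 + Im z ^+ 2)).
Proof. by case: z. Qed.

Definition ReImE := (Re_add, Im_add, Re_opp, Im_opp, Re_mul, Im_mul).

Lemma half_real_complex : (2^-1 : R[i]) = (2^-1 : R)%:C%C.
Proof. by rewrite fmorphV rmorph_nat. Qed.

Lemma normc_sqrtE z : normc z = Num.sqrt (Re z ^+ 2 + Im z ^+ 2).
Proof. by case: z. Qed.

Lemma normc_ge0 z : 0 <= normc z.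
Proof. by rewrite normc_sqrtE sqrtr_ge0. Qed.

Lemma normc_gt0 z : z != 0 -> 0 < normc z.
Proof.
by move=> z0; rewrite lt_def normc_ge0 andbT; apply: contra z0 => /eqP/eq0_normc ->.
Qed.

Lemma normc_triangle z w : normc (z + w) <= normc z + normc w.
Proof. exact: le_normcD. Qed.

Lemma normc_opp z : normc (- z) = normc z.
Proof. exact: normcN. Qed.

Lemma normc_dist z w : normc (z - w) = normc (w - z).
Proof. by rewrite -normc_opp opprB. Qed.

Lemma normc_real x : normc x%:C%C = `|x|.
Proof. by rewrite /= expr0n /= addr0 sqrtr_sqr. Qed.

Lemma normc_imag x : normc (0 +i* x)%C = `|x|.
Proof. by rewrite /= expr0n /= add0r sqrtr_sqr. Qed.

Lemma Re_le_normc z : `|Re z| <= normc z.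
Proof. by rewrite normc_sqrtE -sqrtr_sqr ler_wsqrtr// lerDl sqr_ge0. Qed.

Lemma Im_le_normc z : `|Im z| <= normc z.
Proof. by rewrite normc_sqrtE -sqrtr_sqr ler_wsqrtr// lerDr sqr_ge0. Qed.

Lemma normc_le_ReIm z : normc z <= `|Re z| + `|Im z|.
Proof.
case: z => a b; rewrite -[(a +i* b)%C]/((a +i* b)%C : R[i]).
have -> : (a +i* b)%C = a%:C%C + (0 +i* b)%C by apply: complex_ext; rewrite !ReImE /=; ring.
by rewrite (le_trans (normc_triangle _ _))// normc_real normc_imag !ReImE /= !addr0 add0r.
Qed.

End ComplexCoordinates.

(** * Midpoint sums along segments and squares *)

Section SegmentSums.
Context {R : realType} {W : lmodType R[i]}.
Implicit Types (F G : R[i] -> W) (z d : R[i]) (s : R).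

(** Midpoint rule for the integral of F(w) dw from z to z + d with 2^n steps.
    The midpoints make the sum independent of the orientation up to sign and
    exact on affine functions; the recursion makes refinement definitional. *)
Fixpoint segment_sum F n z d : W :=
  if n is m.+1 then segment_sum F m z (d / 2) + segment_sum F m (z + d / 2) (d / 2)
  else d *: F (z + d / 2).

Lemma segment_sumB F G n z d :
  segment_sum (fun w => F w - G w) n z d = segment_sum F n z d - segment_sum G n z d.
Proof.
elim: n z d => [|n IH] z d /=; first by rewrite scalerBr.
by rewrite !IH opprD addrACA.
Qed.

Lemma segment_sum_affine b c n z d :
  segment_sum (fun w => b + w *: c) n z d = d *: b + (d * z + d ^+ 2 / 2) *: c.
Proof.
elim: n z d => [|n IH] z d /=.
  by rewrite scalerDr scalerA; congr (_ + _ *: _); ring.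
rewrite !IH addrACA -(scalerDl b) -(scalerDl c).
by congr (_ *: _ + _ *: _); field; rewrite ?pnatr_eq0.
Qed.

(** A mean value inequality for any subadditive gauge N that is homogeneous
    under halving: besides a norm, N can be the imaginary part or its opposite,
    which gives one-sided bounds. *)
Lemma segment_sum_le (N : W -> R) F n z d (M : R) :
  (forall u v, N (u + v) <= N u + N v) ->
  (forall u, N (2^-1 *: u) = N u / 2) ->
  (forall t : R, 0 <= t <= 1 -> N (d *: F (z + t%:C%C * d)) <= M) ->
  N (segment_sum F n z d) <= M.
Proof.
move=> ND N2; elim: n z d M => [|n IH] z d M NM /=.
  have -> : d / 2 = (2^-1)%:C%C * d by rewrite mulrC half_real_complex.
  by apply: NM; lra.
have hM z' : (forall t : R, 0 <= t <= 1 -> exists2 t' : R, 0 <= t' <= 1 &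
    z' + t%:C%C * (d / 2) = z + t'%:C%C * d) ->
    N (segment_sum F n z' (d / 2)) <= M / 2.
  move=> h; apply: IH => t t01; have [t' t'01 ->] := h t t01.
  rewrite (_ : d / 2 *: _ = 2^-1 *: (d *: F (z + t'%:C%C * d))); last first.
    by rewrite scalerA mulrC.
  by rewrite N2 ler_pM2r ?invr_gt0// NM.
apply: le_trans (ND _ _) _; rewrite [leRHS](splitr M); apply: lerD; apply: hM => t t01.
  exists (t / 2); first lra.
  by rewrite rmorphM /= -half_real_complex; congr (_ + _); ring.
exists ((1 + t) / 2); first lra.
by rewrite rmorphM rmorphD /= -half_real_complex rmorph1; ring.
Qed.

Definition in_square z s : set R[i] := [set w |
  Re z <= Re w <= Re z + s /\
  Im z <= Im w <= Im z + s].

(** Counterclockwise sum over the boundary of a square; the top and left sides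
    are taken in the positive directions and subtracted, so that sides shared by
    two squares cancel syntactically. *)
Definition contour_sum F n z s : W :=
  segment_sum F n z s%:C%C + segment_sum F n (z + s%:C%C) (0 +i* s)%C
  - segment_sum F n (z + (0 +i* s)%C) s%:C%C - segment_sum F n z (0 +i* s)%C.

Lemma contour_sumB F G n z s :
  contour_sum (fun w => F w - G w) n z s = contour_sum F n z s - contour_sum G n z s.
Proof.
rewrite /contour_sum !segment_sumB !opprD !opprK.
by rewrite !addrA [LHS](ACl (1*3*5*7*2*4*6*8)).
Qed.

(** An affine function has a polynomial primitive of degree two, which the
    midpoint rule integrates exactly, so the sum around a closed curve telescopes. *)
Lemma contour_sum_affine b c n z s : contour_sum (fun w => b + w *: c) n z s = 0.
Proof.
rewrite /contour_sum !segment_sum_affine !opprD -!scaleNr.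
rewrite !addrA [LHS](ACl ((1*3*5*7)*(2*4*6*8))) /= -!(scalerDl b) -!(scalerDl c).
rewrite [X in X *: b + _](_ : _ = 0); last by ring.
rewrite [X in _ + X *: c](_ : _ = 0); last by ring.
by rewrite !scale0r addr0.
Qed.

(** The four inner sides occur twice with opposite signs, and a side cut in two
    carries the same midpoints at level n + 1 as its halves at level n. *)
Lemma contour_sum_split F n z s :
  contour_sum F n.+1 z s = contour_sum F n z (s / 2)
   + contour_sum F n (z + (s / 2)%:C%C) (s / 2)
   + contour_sum F n (z + (0 +i* (s / 2))%C) (s / 2)
   + contour_sum F n (z + (s / 2)%:C%C + (0 +i* (s / 2))%C) (s / 2).
Proof.
rewrite /contour_sum /=.
set h := (s / 2)%:C%C; set v := (0 +i* (s / 2))%C.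
have -> : s%:C%C / 2 = h by rewrite half_real_complex -rmorphM.
have -> : (0 +i* s)%C / 2 = v.
  by rewrite half_real_complex; apply: complex_ext; rewrite !ReImE /=; lra.
have -> : s%:C%C = h + h by rewrite -rmorphD -splitr.
have -> : (0 +i* s)%C = v + v.
  by apply: complex_ext; rewrite !ReImE /= ?addr0 -?splitr.
rewrite -!(addrA z) ![(v + h)%R]addrC.
rewrite !opprD !addrA.
(* The eight outer half sides, followed by the four cancelling pairs. *)
rewrite [RHS](ACl ((1*5*6*14*11*15*4*12)*(2*8)*(3*9)*(7*13)*(10*16))) /=.
rewrite !subrr !addNr !addr0.
by rewrite [z + h + v + h]addrAC (_ : z + h + v + v = z + v + v + h)//; ring.
Qed.

End SegmentSums.

Lemma contour_sum_scalel (R : realType) (W : lmodType R[i]) (k : R[i] -> R[i]^o) (b : W) n z s :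
  contour_sum (fun w => k w *: b) n z s = contour_sum k n z s *: b.
Proof.
have seg z' d : segment_sum (fun w => k w *: b) n z' d = segment_sum k n z' d *: b.
  by elim: n z' d => [|n IH] z' d /=; rewrite ?scalerA// !IH -scalerDl.
by rewrite /contour_sum !seg -scalerDl -!scalerBl.
Qed.

(** * Bisection of squares *)

Section Bisection.
Context {R : realType}.

Lemma nested_intervals (a b : nat -> R) :
  {homo a : m n / (m <= n)%N >-> m <= n} ->
  {homo b : m n / (m <= n)%N >-> n <= m} -> (forall n, a n <= b n) ->
  exists x, forall n, a n <= x <= b n.
Proof.
move=> ha hb ab.
have ubb n : ubound (range a) (b n).
  move=> _ [m _ <-]; apply: le_trans (ha _ _ (leq_maxl m n)) _.
  exact: le_trans (ab _) (hb _ _ (leq_maxr m n)).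
have a0 : has_sup (range a) by split; [exists (a 0%N), 0%N | exists (b 0%N)].
exists (sup (range a)) => n; apply/andP; split.
  by apply: ub_le_sup; [exact: a0.2 | exists n].
by apply: ge_sup; [exact: a0.1 | exact: ubb].
Qed.

Lemma halving_lt (s e : R) : 0 < e -> exists n, s / 2 ^+ n < e.
Proof.
move=> e0; exists (Num.bound (s / e)).
rewrite ltr_pdivrMr ?exprn_gt0// mulrC -ltr_pdivrMr//.
exact: upper_nthrootP.
Qed.

(** Cousin's lemma for squares: if T fails for a square, it fails for one of its
    quarters, and the nested squares so chosen shrink to a point where T holds
    locally. *)
Lemma square_bisection (T : R[i] -> R -> Prop) (z0 : R[i]) (s0 : R) : 0 < s0 ->
  (forall z s, 0 < s -> T z (s / 2) -> T (z + (s / 2)%:C%C) (s / 2) ->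
     T (z + (0 +i* (s / 2))%C) (s / 2) ->
     T (z + (s / 2)%:C%C + (0 +i* (s / 2))%C) (s / 2) -> T z s) ->
  (forall w, in_square z0 s0 w -> exists2 e, 0 < e &
     forall z s, 0 < s < e -> in_square z s w -> T z s) ->
  T z0 s0.
Proof.
move=> s0_gt0 Tsplit Tloc; apply: contrapT => nT0.
pose sub (q q' : R[i] * R) := q'.2 = q.2 / 2 /\
  (Re q.1 <= Re q'.1 /\
   Re q'.1 + q'.2 <= Re q.1 + q.2) /\
  (Im q.1 <= Im q'.1 /\
   Im q'.1 + q'.2 <= Im q.1 + q.2).
have /choice[step stepP] (q : R[i] * R) : exists q' : R[i] * R,
    0 < q.2 /\ ~ T q.1 q.2 -> ~ T q'.1 q'.2 /\ sub q q'.
  case: q => z s /=.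
  have [[s_gt0 nT]|] := pselect (0 < s /\ ~ T z s); last by exists (z, s).
  apply: contrapT => /forallNP nex; apply: nT.
  apply: Tsplit => //; apply: contrapT => nT.
  - by apply: (nex (z, s / 2)) => _; split => //; rewrite /sub /=; do !split; lra.
  - apply: (nex (z + (s / 2)%:C%C, s / 2)) => _; split => //.
    by rewrite /sub /= !ReImE /=; do !split; lra.
  - apply: (nex (z + (0 +i* (s / 2))%C, s / 2)) => _; split => //.
    by rewrite /sub /= !ReImE /=; do !split; lra.
  - apply: (nex (z + (s / 2)%:C%C + (0 +i* (s / 2))%C, s / 2)) => _; split => //.
    by rewrite /sub /= !ReImE /=; do !split; lra.
pose q n := iter n step (z0, s0).
have qP n : [/\ 0 < (q n).2, ~ T (q n).1 (q n).2 & (q n).2 = s0 / 2 ^+ n].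
  elim: n => [|n [IH1 IH2 IH3]]; first by rewrite /= expr0 divr1.
  have [nT [e _]] := stepP _ (conj IH1 IH2).
  rewrite /q iterS -/(q n); split => //; first by rewrite e divr_gt0.
  by rewrite e IH3 exprSr invfM mulrA.
have qsub n : sub (q n) (q n.+1) by have [h1 h2 _] := qP n; have [] := stepP _ (conj h1 h2).
have [x xP] : exists x, forall n, Re (q n).1 <= x <= Re (q n).1 + (q n).2.
  apply: nested_intervals.
  - by apply: (homo_leq lexx le_trans) => n; have [_ [[]]] := qsub n.
  - apply: (homo_leq (r := fun a b : R => b <= a)) => [a|a b c ab bc|n] //.
      exact: le_trans bc ab.
    by have [_ [[]]] := qsub n.
  - by move=> n; rewrite lerDl; have [/ltW] := qP n.
have [y yP] : exists y, forall n, Im (q n).1 <= y <= Im (q n).1 + (q n).2.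
  apply: nested_intervals.
  - by apply: (homo_leq lexx le_trans) => n; have [_ [_ []]] := qsub n.
  - apply: (homo_leq (r := fun a b : R => b <= a)) => [a|a b c ab bc|n] //.
      exact: le_trans bc ab.
    by have [_ [_ []]] := qsub n.
  - by move=> n; rewrite lerDl; have [/ltW] := qP n.
have [e e_gt0 Te] := Tloc (x +i* y)%C (conj (xP 0%N) (yP 0%N)).
have [n ne] := halving_lt s0 e_gt0.
have [qn_gt0 nT eqn] := qP n; apply: nT; apply: Te; first by rewrite qn_gt0 eqn.
by split; [exact: xP | exact: yP].
Qed.

End Bisection.

(** * Complex differentiability and the Goursat argument *)

Section ComplexDifferentiability.
Context {R : realType} {W : lmodType R[i]} (nrm : W -> R).
Context (nrmD : forall u v, nrm (u + v) <= nrm u + nrm v).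
Context (nrmZ : forall k u, nrm (k *: u) = normc k * nrm u).
Implicit Types (F G : R[i] -> W) (z w a c : R[i]) (s : R).

Lemma nrm0 : nrm 0 = 0.
Proof. by rewrite -(scale0r 0) nrmZ normc0 mul0r. Qed.

Lemma nrmN u : nrm (- u) = nrm u.
Proof. by rewrite -scaleN1r nrmZ normc_opp normc1 mul1r. Qed.

Lemma nrmB u v : nrm (u - v) <= nrm u + nrm v.
Proof. by rewrite -(nrmN v). Qed.

Lemma nrm_ge0 u : 0 <= nrm u.
Proof. by have := nrmB u u; rewrite subrr nrm0; lra. Qed.

Lemma nrm_half u : nrm (2^-1 *: u) = nrm u / 2.
Proof. by rewrite nrmZ half_real_complex normc_real ger0_norm ?invr_ge0// mulrC. Qed.

Definition on_boundary z s : set R[i] := [set w | in_square z s w /\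
  ((Re w = Re z \/ Re w = Re z + s) \/
   (Im w = Im z \/ Im w = Im z + s))].

Lemma nrm_contour_sum_le F n z s (M : R) : 0 <= s ->
  (forall w, on_boundary z s w -> nrm (F w) <= M) ->
  nrm (contour_sum F n z s) <= 4 * (s * M).
Proof.
move=> s0 FM.
have seg z' d : normc d = s ->
    (forall t : R, 0 <= t <= 1 -> on_boundary z s (z' + t%:C%C * d)) ->
    nrm (segment_sum F n z' d) <= s * M.
  move=> ds h; apply: (@segment_sum_le _ _ nrm F n z' d _ nrmD nrm_half) => t t01.
  by rewrite nrmZ ds ler_wpM2l// FM//; exact: h.
have h4 : 4 * (s * M) = s * M + s * M + s * M + s * M by ring.
have [e1 e2] : normc s%:C%C = s /\ normc (0 +i* s)%C = s.
  by rewrite normc_real normc_imag ger0_norm.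
rewrite h4 /contour_sum; do !(apply: le_trans (nrmB _ _) _; apply: lerD).
  apply: le_trans (nrmD _ _) _; apply: lerD.
all: apply: seg => // t t01.
all: rewrite /on_boundary /in_square /mkset !ReImE /=.
all: have ? : 0 <= t * s <= s by move: t01; nra.
- by split; [split; lra|right; left; lra].
- by split; [split; lra|left; right; lra].
- by split; [split; lra|right; right; lra].
- by split; [split; lra|left; left; lra].
Qed.

(** W carries no topology: the limit is expressed with the seminorm [nrm]. *)
Definition cdifferentiable F z := exists d, forall e, 0 < e -> exists2 r, 0 < r &
  forall w, normc (w - z) < r -> nrm (F w - F z - (w - z) *: d) <= e * normc (w - z).

Lemma cdifferentiable_near F G z r : 0 < r -> (forall w, normc (w - z) < r -> F w = G w) ->
  cdifferentiable F z -> cdifferentiable G z.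
Proof.
move=> r0 FG [d dP]; exists d => e e0; have [r' r'0 r'P] := dP e e0.
exists (Num.min r r'); first by rewrite lt_min r0.
move=> w; rewrite lt_min => /andP[wr wr'].
by rewrite -!FG ?subrr ?normc0//; exact: r'P.
Qed.

Lemma cdifferentiable_cst b z : cdifferentiable (fun=> b) z.
Proof.
exists 0 => e e0; exists 1 => // w _.
by rewrite subrr scaler0 subr0 nrm0 mulr_ge0 ?normc_ge0 ?ltW.
Qed.

Lemma cdifferentiableB F G z :
  cdifferentiable F z -> cdifferentiable G z ->
  cdifferentiable (fun w => F w - G w) z.
Proof.
move=> [d dP] [d' d'P]; exists (d - d') => e e0.
have e20 : 0 < e / 2 by rewrite divr_gt0.
have [r r0 rP] := dP _ e20; have [r' r'0 r'P] := d'P _ e20.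
exists (Num.min r r'); first by rewrite lt_min r0.
move=> w; rewrite lt_min => /andP[/rP wr /r'P wr'].
have -> : F w - G w - (F z - G z) - (w - z) *: (d - d') =
    (F w - F z - (w - z) *: d) - (G w - G z - (w - z) *: d').
  by rewrite scalerBr !opprB !addrA [LHS](ACl (1*4*6*5*3*2)).
by apply: le_trans (nrmB _ _) _; lra.
Qed.

Lemma cdifferentiable_lipschitz F z : cdifferentiable F z -> exists M : R, exists2 r, 0 < r &
  forall w, normc (w - z) < r -> nrm (F w - F z) <= M * normc (w - z).
Proof.
move=> [d dP]; have [r r0 rP] := dP 1 ltr01; exists (1 + nrm d), r => // w wr.
rewrite -(subrK ((w - z) *: d) (F w - F z)) (le_trans (nrmD _ _))// nrmZ.
by have := rP w wr; lra.
Qed.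

Lemma cdifferentiable_locally_bounded F z : cdifferentiable F z ->
  exists M : R, exists2 r, 0 < r &
  forall w, normc (w - z) < r -> nrm (F w) <= M.
Proof.
move=> /cdifferentiable_lipschitz[M [r r0 rP]]; exists (`|M| * r + nrm (F z)), r => // w wr.
rewrite -(subrK (F z) (F w)) (le_trans (nrmD _ _))// lerD2r.
apply: le_trans (rP w wr) _; apply: (@le_trans _ _ (`|M| * normc (w - z))).
  by rewrite ler_wpM2r ?normc_ge0// ler_norm.
by rewrite ler_wpM2l// ltW.
Qed.

(** Product rule for the Cauchy kernel: with k = (z - c)^-1 the derivative is
    k d - k^2 F(z), and the error is (w - c)^-1 times the error of F minus a
    term of second order in w - z. *)
Lemma cdifferentiable_kernel F c z : z != c -> cdifferentiable F z ->
  cdifferentiable (fun w => (w - c)^-1 *: F w) z.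
Proof.
move=> zc [d dP]; set k := (z - c)^-1; pose D := k *: d - k ^+ 2 *: F z.
exists D => e e0.
have zc0 : z - c != 0 by rewrite subr_eq0.
pose K := normc k.
have K0 : 0 < K by rewrite normc_gt0// invr_eq0.
have eK0 : 0 < e / (4 * K) by rewrite divr_gt0// mulr_gt0.
have D0 : 0 < 1 + nrm D by have := nrm_ge0 D; lra.
have [r r0 rP] := dP _ eK0.
exists (Num.min r (Num.min (1 / (2 * K)) (e / (4 * K) / (1 + nrm D)))).
  by rewrite !lt_min r0 !divr_gt0 ?mulr_gt0.
move=> w; rewrite !lt_min => /and3P[wr wK we].
set m := (w - c)^-1.
have wc0 : w - c != 0.
  apply/eqP => wc0; move: wK; have -> : w - z = - (z - c) by rewrite -[w](subrK c) wc0; ring.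
  rewrite normc_opp -[z - c]invrK -/k normcV -/K => h.
  by have := h; rewrite div1r invfM ltNge ler_piMl ?invr_ge0 ?(ltW K0)//; lra.
(* The resolvent identity, which gives |m| <= 2 |k| for w close to z. *)
have mE : m = k - (w - z) * k * m.
  by rewrite /m /k; field; rewrite zc0 wc0.
have mK : normc m <= 2 * K.
  have := normc_triangle k (- ((w - z) * k * m)).
  rewrite -mE normc_opp !normcM -/K.
  have : normc (w - z) * K <= 1 / 2.
    rewrite -ler_pdivlMr// -(ler_pM2r (_ : 0 < 2)) // -mulrA.
    by move: wK; rewrite div1r invfM => /ltW; lra.
  have := normc_ge0 m; nra.
have -> : m *: F w - k *: F z - (w - z) *: D =
    m *: ((F w - F z - (w - z) *: d) - (w - z) ^+ 2 *: D).
  transitivity (m *: F w + ((w - z) * k ^+ 2 - k) *: F z - ((w - z) * k) *: d).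
    by rewrite /D scalerBr !scalerA scalerBl opprB !addrA [LHS](ACl (1*3*2*4)).
  rewrite !scalerBr !scalerA opprB !addrA [RHS](ACl (1*(4*2)*(3*5))) /=.
  by rewrite -opprD -scalerBl -scalerDl; congr (_ + _ *: _ - _ *: _);
    rewrite /m /k; field; rewrite zc0 wc0.
rewrite nrmZ; have h1 := rP w wr; have h2 := normc_ge0 (w - z).
apply: (@le_trans _ _ (2 * K * (e / (4 * K) * normc (w - z) + e / (4 * K) * normc (w - z)))).
  apply: ler_pM => //; rewrite ?normc_ge0 ?nrm_ge0//.
  apply: le_trans (nrmB _ _) _; apply: lerD => //.
  rewrite nrmZ expr2 normcM -mulrA mulrC ler_wpM2r//.
  move: we; rewrite ltr_pdivlMr// => /ltW; apply: le_trans.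
  by rewrite ler_wpM2l//; have := nrm_ge0 D; lra.
by rewrite le_eqVlt; apply/orP; left; apply/eqP; field; rewrite gt_eqF.
Qed.

(** Subtracting the affine approximation of F at z does not change the sum, and
    what is left is o(s) on a boundary of length 4 s. *)
Lemma contour_sum_small_near F z e : cdifferentiable F z -> 0 < e -> exists2 r, 0 < r &
  forall z' s n, 0 < s < r -> in_square z' s z -> nrm (contour_sum F n z' s) <= e * s ^+ 2.
Proof.
move=> [d dP] e0; have e80 : 0 < e / 8 by rewrite divr_gt0.
have [r r0 rP] := dP _ e80; exists (r / 2); first by rewrite divr_gt0.
move=> z' s n /andP[s0 sr] [z'1 z'2].
rewrite (_ : contour_sum F n z' s =
    contour_sum (fun w => F w - (F z - z *: d + w *: d)) n z' s); last first.
  by rewrite contour_sumB contour_sum_affine subr0.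
apply: le_trans (@nrm_contour_sum_le _ n z' s (e / 8 * (2 * s)) (ltW s0) _) _; last first.
  by rewrite le_eqVlt; apply/orP; left; apply/eqP; field.
move=> w [[w1 w2] _].
have wz : normc (w - z) <= 2 * s.
  apply: le_trans (normc_le_ReIm _) _; rewrite !ReImE mulr_natl mulr2n.
  by apply: lerD; rewrite ler_norml; lra.
rewrite (_ : F w - _ = F w - F z - (w - z) *: d); last first.
  by rewrite scalerBl opprD !opprB !addrA [LHS](ACl (1*3*2*4)).
by apply: le_trans (rP w _) _; [lra | rewrite ler_wpM2l// ltW].
Qed.

(** The number of intervals among [x, x + s[ and ]x, x + s] that contain a.  It
    is additive under bisection, as an indicator of a half-open interval is, and
    still at least 1 when a lies in the closed interval: products of two such
    counts act as a point mass for squares containing the exceptional point. *)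
Definition halfopen_count (x s a : R) : R := ((x <= a < x + s)%R + (x < a <= x + s)%R)%:R.

Lemma halfopen_count_split x s (a : R) : 0 < s ->
  halfopen_count x s a =
  halfopen_count x (s / 2) a + halfopen_count (x + s / 2) (s / 2) a.
Proof.
move=> s0; rewrite /halfopen_count -natrD; congr (_%:R).
have -> : x + s / 2 + s / 2 = x + s by lra.
have -> : (x <= a < x + s)%R = ((x <= a < x + s / 2)%R + (x + s / 2 <= a < x + s)%R)%N :> nat.
  rewrite (leNgt (x + s / 2)); case: (leP x a) => ?; case: (ltP a (x + s / 2)) => ?;
    case: (ltP a (x + s)) => ? //=; exfalso; lra.
have -> : (x < a <= x + s)%R = ((x < a <= x + s / 2)%R + (x + s / 2 < a <= x + s)%R)%N :> nat.
  rewrite (ltNge (x + s / 2)); case: (ltP x a) => ?; case: (leP a (x + s / 2)) => ?;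
    case: (leP a (x + s)) => ? //=; exfalso; lra.
by rewrite addnACA.
Qed.

Lemma halfopen_count_ge0 x s (a : R) : 0 <= halfopen_count x s a.
Proof. exact: ler0n. Qed.

Lemma halfopen_count_ge1 x s (a : R) : 0 < s -> x <= a <= x + s -> 1 <= halfopen_count x s a.
Proof.
move=> s0 /andP[xa ax]; rewrite ler1n addn_gt0 !lt0b xa ax /= andbT.
by case: ltP => //= ?; lra.
Qed.

Definition contour_sum_cvg0 F z s := forall e, 0 < e ->
  exists N, forall n, (N <= n)%N -> nrm (contour_sum F n z s) <= e.

(** Bisection with the weight s^2 + (point mass at a): away from a the sums are
    o(s^2), and near a they are O(s), which the point mass absorbs. *)
Lemma goursat F a z0 s0 r (M : R) : 0 < s0 -> 0 < r ->
  (forall w, in_square z0 s0 w -> w != a -> cdifferentiable F w) ->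
  (forall w, normc (w - a) < r -> nrm (F w) <= M) ->
  contour_sum_cvg0 F z0 s0.
Proof.
move=> s0_gt0 r0 Fd FM e e0.
pose weight z s := s ^+ 2 + halfopen_count (Re z) s (Re a) *
                            halfopen_count (Im z) s (Im a).
have weight_gt0 z s : 0 < s -> 0 < weight z s.
  by move=> s_gt0; rewrite ltr_wpDr ?exprn_gt0// mulr_ge0 ?halfopen_count_ge0.
have e'0 : 0 < e / weight z0 s0 by rewrite divr_gt0 ?weight_gt0.
rewrite -(divfK (lt0r_neq0 (weight_gt0 z0 _ s0_gt0)) e).
move: (e / _) e'0 => {e0}e e0.
pose T z s := exists N, forall n, (N <= n)%N -> nrm (contour_sum F n z s) <= e * weight z s.
apply: (square_bisection (T := T)) => // [z s s_gt0 [n1 P1] [n2 P2] [n3 P3] [n4 P4]|w ws0].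
  exists (maxn (maxn n1 n2) (maxn n3 n4)).+1; case=> // n; rewrite ltnS !geq_max.
  move=> /andP[/andP[/P1 {}P1 /P2 {}P2] /andP[/P3 {}P3 /P4 {}P4]].
  rewrite contour_sum_split /weight.
  rewrite (halfopen_count_split (Re z) _ s_gt0) (halfopen_count_split (Im z) _ s_gt0).
  move: P1 P2 P3 P4; rewrite /weight !ReImE /= !addr0.
  set k1 := halfopen_count _ _ _; set k2 := halfopen_count _ _ _.
  set k3 := halfopen_count _ _ _; set k4 := halfopen_count _ _ _.
  move=> P1 P2 P3 P4.
  rewrite (_ : e * _ = e * ((s / 2) ^+ 2 + k1 * k2) + e * ((s / 2) ^+ 2 + k3 * k2) +
     e * ((s / 2) ^+ 2 + k1 * k4) + e * ((s / 2) ^+ 2 + k3 * k4)); last by field.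
  by do 3!(apply: le_trans (nrmD _ _) _; apply: lerD => //).
have [->|wa] := eqVneq w a.
  have M0 : 0 <= M by apply: le_trans (nrm_ge0 _) (FM a _); rewrite subrr normc0.
  exists (Num.min (r / 2) (e / (4 * (M + 1)))).
    by rewrite lt_min !divr_gt0 ?mulr_gt0//; lra.
  move=> z s /andP[s_gt0]; rewrite lt_min => /andP[sr sM] [az1 az2].
  exists 0%N => n _; apply: (@le_trans _ _ (4 * (s * M))).
    apply: nrm_contour_sum_le => [|v [[v1 v2] _]]; first exact: ltW.
    apply: FM; apply: le_lt_trans (normc_le_ReIm _) _; rewrite !ReImE.
    apply: (@le_lt_trans _ _ (s + s)); last lra.
    by apply: lerD; rewrite ler_norml; lra.
  apply: (@le_trans _ _ (e * 1)).
    by move: sM; rewrite ltr_pdivlMr; [nra | lra].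
  rewrite ler_pM2l//.
  have k1 := halfopen_count_ge1 s_gt0 az1; have k2 := halfopen_count_ge1 s_gt0 az2.
  by rewrite /weight; have := sqr_ge0 s; nra.
have [r' r'0 r'P] := contour_sum_small_near (Fd w ws0 wa) e0.
exists r' => // z s sr wz; exists 0%N => n _; apply: le_trans (r'P z s n sr wz) _.
by rewrite ler_pM2l// lerDl mulr_ge0 ?halfopen_count_ge0.
Qed.

End ComplexDifferentiability.

(** * The Cauchy estimate and unique continuation *)

Section CauchyKernel.
Context {R : realType}.

Definition square_corner (a : R[i]) (s : R) : R[i] := a - (s +i* s)%C.

(** The limit is 2 pi i.  The bound 4 already holds at every level n: on each
    side the contribution has imaginary part s / (u^2 + s^2) du with |u| <= s,
    hence at least 1 / (2 s) per unit of length. *)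
Lemma cauchy_kernel_contour_sum_ge4 (a : R[i]) (s : R) n : 0 < s ->
  4 <= Im (contour_sum (fun w => (w - a)^-1 : R[i]^o) n (square_corner a s) (2 * s)).
Proof.
move=> s0.
have bnd (u : R) : 0 <= u <= 1 -> 1 <= 2 * s * (s / ((- s + u * (2 * s)) ^+ 2 + s ^+ 2)).
  move=> u01; have d0 : 0 < (- s + u * (2 * s)) ^+ 2 + s ^+ 2.
    by rewrite ltr_wpDl ?sqr_ge0// exprn_gt0.
  by rewrite mulrA ler_pdivlMr// -subr_ge0
    (_ : _ - _ = 4 * (s ^+ 2 * (u * (1 - u)))); [rewrite !mulr_ge0 ?sqr_ge0//; lra | ring].
have half (u : R[i]^o) : Im (2^-1 *: u) = Im u / 2.
  by rewrite half_real_complex !ReImE /= mul0r addr0 mulrC.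
have halfN (u : R[i]^o) : - Im (2^-1 *: u) = - Im u / 2.
  by rewrite half mulNr.
have addI (u v : R[i]^o) : Im (u + v) <= Im u + Im v.
  by rewrite Im_add.
have addIN (u v : R[i]^o) : - Im (u + v) <= - Im u + - Im v.
  by rewrite Im_add opprD.
pose k (w : R[i]) : R[i]^o := (w - a)^-1.
have hor z d : (forall t : R, 0 <= t <= 1 -> 1 <= Im (d * k (z + t%:C%C * d))) ->
    1 <= Im (segment_sum k n z d).
  by move=> h; rewrite -lerN2; apply: (@segment_sum_le _ _ (fun u => - Im u)) => // t t01;
    rewrite lerN2; exact: h.
have ver z d : (forall t : R, 0 <= t <= 1 -> Im (d * k (z + t%:C%C * d)) <= -1) ->
    Im (segment_sum k n z d) <= -1.
  by move=> h; apply: (@segment_sum_le _ _ (fun u => Im u)) => // t t01; exact: h.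
(* Top and left sides are subtracted, hence the opposite bound for them. *)
rewrite /contour_sum -/k !ReImE.
have kIm (d p : R[i]) : Im (d * p^-1) =
    (Im d * Re p - Re d * Im p) /
    (Re p ^+ 2 + Im p ^+ 2).
  by rewrite Im_mul Re_inv Im_inv; ring.
have b1 : 1 <= Im (segment_sum k n (square_corner a s) (2 * s)%:C%C).
  apply: hor => t t01; rewrite /k kIm.
  apply: le_trans (bnd t t01) _; rewrite mulrA le_eqVlt; apply/orP; left; apply/eqP.
  by congr (_ / _); rewrite /square_corner !ReImE /=; ring.
have b2 : 1 <= Im (segment_sum k n (square_corner a s + (2 * s)%:C%C) (0 +i* (2 * s))%C).
  apply: hor => t t01; rewrite /k kIm.
  apply: le_trans (bnd t t01) _; rewrite mulrA le_eqVlt; apply/orP; left; apply/eqP.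
  by congr (_ / _); rewrite /square_corner !ReImE /=; ring.
have b3 : Im (segment_sum k n (square_corner a s + (0 +i* (2 * s))%C) (2 * s)%:C%C) <= -1.
  apply: ver => t t01; rewrite /k kIm lerNr.
  apply: le_trans (bnd t t01) _; rewrite mulrA -mulNr le_eqVlt; apply/orP; left; apply/eqP.
  by congr (_ / _); rewrite /square_corner !ReImE /=; ring.
have b4 : Im (segment_sum k n (square_corner a s) (0 +i* (2 * s))%C) <= -1.
  apply: ver => t t01; rewrite /k kIm lerNr.
  apply: le_trans (bnd t t01) _; rewrite mulrA -mulNr le_eqVlt; apply/orP; left; apply/eqP.
  by congr (_ / _); rewrite /square_corner !ReImE /=; ring.
by lra.
Qed.

End CauchyKernel.

Section UniqueContinuation.
Context {R : realType} {W : lmodType R[i]} (nrm : W -> R).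
Context (nrmD : forall u v, nrm (u + v) <= nrm u + nrm v).
Context (nrmZ : forall k u, nrm (k *: u) = normc k * nrm u).
Implicit Types (F G : R[i] -> W) (z w a c : R[i]) (s : R).

Lemma in_centered_square a s w : in_square (square_corner a s) (2 * s) w <->
  `|Re (w - a)| <= s /\ `|Im (w - a)| <= s.
Proof.
rewrite /in_square /mkset /square_corner !ReImE /= !ler_norml; split=> -[h1 h2]; split; lra.
Qed.

(** The sums of (F(w) - F(a)) / (w - a) tend to 0 by [goursat], this quotient
    being bounded near a.  Those of F(a) / (w - a) have norm at least 4 |F(a)|,
    and those of F(w) / (w - a) at most (8 s) (M / s). *)
Lemma cauchy_estimate F a s (M : R) : 0 < s ->
  (forall w, in_square (square_corner a s) (2 * s) w -> cdifferentiable nrm F w) ->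
  (forall w, in_square (square_corner a s) (2 * s) w -> s <= normc (w - a) -> nrm (F w) <= M) ->
  nrm (F a) <= 2 * M.
Proof.
move=> s0 Fd FM; have s20 : 0 < 2 * s by rewrite mulr_gt0.
set z0 := square_corner a s in Fd FM *.
have aS : in_square z0 (2 * s) a by apply/in_centered_square; rewrite subrr /= normr0; lra.
pose G w := (w - a)^-1 *: (F w - F a).
have Gd w : in_square z0 (2 * s) w -> w != a -> cdifferentiable nrm G w.
  move=> ws wa; apply: (cdifferentiable_kernel nrmD nrmZ) => //.
  by apply: (cdifferentiableB nrmD nrmZ) (Fd _ ws) (cdifferentiable_cst nrmZ _ _).
have [L [r r0 rL]] := cdifferentiable_lipschitz nrmD nrmZ (Fd a aS).
have GL w : normc (w - a) < r -> nrm (G w) <= `|L|.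
  move=> /rL h; rewrite /G nrmZ normcV.
  have [->|wa] := eqVneq w a; first by rewrite subrr normc0 invr0 mul0r.
  have wa0 : 0 < normc (w - a) by rewrite normc_gt0// subr_eq0.
  by rewrite mulrC ler_pdivrMr//; have := ler_norm L; nra.
apply/ler_addgt0Pr => e e0; have e20 : 0 < 4 * e by rewrite mulr_gt0.
have [n /(_ _ (leqnn n)) nP] := goursat nrmD nrmZ s20 r0 Gd GL e20.
have S1 : nrm (contour_sum (fun w => (w - a)^-1 *: F w) n z0 (2 * s)) <=
    4 * ((2 * s) * (s^-1 * M)).
  apply: (nrm_contour_sum_le nrmD nrmZ); first exact: ltW.
  move=> w [ws wb]; have swa : s <= normc (w - a).
    case: wb => wb; [apply: le_trans (Re_le_normc _)|apply: le_trans (Im_le_normc _)];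
    by move: wb; rewrite /z0 /square_corner !ReImE /= ler_normr => -[->|->]; lra.
  rewrite nrmZ normcV ler_pM ?invr_ge0 ?normc_ge0 ?(nrm_ge0 nrmD nrmZ) ?FM//.
  by rewrite lef_pV2// posrE (lt_le_trans s0).
have S2 : 4 * nrm (F a) <= nrm (contour_sum (fun w => (w - a)^-1 *: F a) n z0 (2 * s)).
  rewrite (contour_sum_scalel (fun w => (w - a)^-1)) nrmZ ler_wpM2r ?(nrm_ge0 nrmD nrmZ)//.
  apply: le_trans (cauchy_kernel_contour_sum_ge4 a n s0) _.
  exact: le_trans (ler_norm _) (Im_le_normc _).
have S3 : nrm (contour_sum (fun w => (w - a)^-1 *: F a) n z0 (2 * s)) <=
    nrm (contour_sum (fun w => (w - a)^-1 *: F w) n z0 (2 * s)) +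
    nrm (contour_sum G n z0 (2 * s)).
  have -> : contour_sum G n z0 (2 * s) = contour_sum (fun w => (w - a)^-1 *: F w) n z0 (2 * s) -
     contour_sum (fun w => (w - a)^-1 *: F a) n z0 (2 * s).
    by rewrite -contour_sumB; congr contour_sum; apply: funext => w; rewrite /G scalerBr.
  set A := contour_sum _ _ _ _; set B := contour_sum _ _ _ _.
  by rewrite -{1}(subKr B A); exact: (nrmB nrmD nrmZ).
have : 4 * (2 * s * (s^-1 * M)) = 8 * M by field; rewrite gt_eqF.
lra.
Qed.

Lemma cdifferentiable_bounded_square F z s : 0 < s ->
  (forall w, in_square z s w -> cdifferentiable nrm F w) ->
  exists M : R, forall w, in_square z s w -> nrm (F w) <= M.
Proof.
move=> s0 Fd.
pose T z s := exists M : R, forall w, in_square z s w -> nrm (F w) <= M.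
apply: (square_bisection (T := T)) => // [z1 s1 s10 [m1 P1] [m2 P2] [m3 P3] [m4 P4]|w ws].
  exists (Num.max (Num.max m1 m2) (Num.max m3 m4)) => w [w1 w2].
  rewrite !le_max.
  have [h1|h1] := leP (Re w) (Re z1 + s1 / 2);
  have [h2|h2] := leP (Im w) (Im z1 + s1 / 2).
  - by rewrite P1//; split; lra.
  - by rewrite (P3 w) ?orbT//; split; rewrite !ReImE /=; lra.
  - by rewrite (P2 w) ?orbT//; split; rewrite !ReImE /=; lra.
  - by rewrite (P4 w) ?orbT//; split; rewrite !ReImE /=; lra.
have [M [r r0 rM]] := cdifferentiable_locally_bounded nrmD nrmZ (Fd w ws).
exists (r / 2); first by rewrite divr_gt0.
move=> z' s' /andP[s'0 s'r] [w1 w2]; exists M => v [v1 v2]; apply: rM.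
apply: le_lt_trans (normc_le_ReIm _) _; rewrite !ReImE.
apply: (@le_lt_trans _ _ (s' + s')); last lra.
by apply: lerD; rewrite ler_norml; lra.
Qed.

(** The estimate is applied to (w - c)^-n F(w).  With rho = |a - c|, points of the
    square with |w - a| >= s satisfy |w - c| >= s - rho >= 2 rho, so that
    |F(a)| <= 2 M (rho / (s - rho))^n <= 2 M / 2^n. *)
Lemma unique_continuation F a c s r : 0 < s -> 0 < r -> normc (a - c) < s / 3 ->
  (forall w, in_square (square_corner a s) (2 * s) w -> cdifferentiable nrm F w) ->
  (forall w, normc (w - c) < r -> F w = 0) -> nrm (F a) = 0.
Proof.
move=> s0 r0 acs Fd F0; have s20 : 0 < 2 * s by rewrite mulr_gt0.
have [->|ac] := eqVneq a c; first by rewrite F0 ?subrr ?normc0 ?(nrm0 nrmZ).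
have [M FM] := cdifferentiable_bounded_square s20 Fd.
pose Fn n w := (w - c)^-1 ^+ n *: F w.
have Fn0 n w : normc (w - c) < r -> Fn n w = 0 by move=> /F0 wc; rewrite /Fn wc scaler0.
have Fnd n w : in_square (square_corner a s) (2 * s) w -> cdifferentiable nrm (Fn n) w.
  move=> ws; have [->|wc] := eqVneq w c.
    apply: (@cdifferentiable_near _ _ nrm (fun=> 0) _ _ r) => //.
      by move=> v vc; rewrite Fn0.
    exact: cdifferentiable_cst.
  elim: n => [|n IH].
    by rewrite (_ : Fn 0%N = F); [exact: Fd | apply: funext => v; rewrite /Fn expr0 scale1r].
  rewrite (_ : Fn n.+1 = fun v => (v - c)^-1 *: Fn n v); first exact: cdifferentiable_kernel.
  by apply: funext => v; rewrite /Fn exprS scalerA.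
pose rho := normc (a - c); have rho0 : 0 < rho by rewrite normc_gt0// subr_eq0.
have srho : 0 < s - rho by move: acs; rewrite -/rho; lra.
have est n : nrm (Fn n a) <= 2 * ((s - rho)^-1 ^+ n * M).
  apply: (cauchy_estimate s0 (Fnd n)) => w ws wa.
  have M0 : 0 <= M by apply: le_trans (nrm_ge0 nrmD nrmZ _) (FM w ws).
  have h : s - rho <= normc (w - c).
    rewrite lerBlDr /rho [normc (a - c)]normc_dist; apply: le_trans wa _.
    by apply: le_trans (normc_triangle _ _); rewrite addrA subrK.
  rewrite /Fn nrmZ; apply: ler_pM; rewrite ?normc_ge0 ?(nrm_ge0 nrmD nrmZ) ?FM//.
  have -> : normc ((w - c)^-1 ^+ n) = (normc (w - c))^-1 ^+ n.
    by elim: n => [|n IH]; rewrite ?expr0 ?normc1// !exprS normcM normcV IH.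
  rewrite lerXn2r ?nnegrE ?invr_ge0 ?normc_ge0 ?(ltW srho)//.
  by rewrite lef_pV2 ?posrE ?(lt_le_trans srho).
apply/eqP; rewrite eq_le (nrm_ge0 nrmD nrmZ) andbT.
apply/ler_addgt0Pr => e e0; rewrite add0r.
have M1 : 0 < 2 * (`|M| + 1) by have := normr_ge0 M; lra.
have [n ne] := halving_lt (2 * (`|M| + 1)) e0.
have := est n; rewrite /Fn nrmZ.
have -> : normc ((a - c)^-1 ^+ n) = rho^-1 ^+ n.
  by elim: (n) => [|m IH]; rewrite ?expr0 ?normc1// !exprS normcM normcV IH.
move=> h; apply: le_trans (ltW ne).
rewrite -(ler_pM2l (_ : 0 < rho^-1 ^+ n)) ?exprn_gt0 ?invr_gt0//.
apply: le_trans h _.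
have h2 : (s - rho)^-1 ^+ n <= rho^-1 ^+ n * 2^-1 ^+ n.
  rewrite -exprMn lerXn2r ?nnegrE ?mulr_ge0 ?invr_ge0 ?(ltW srho) ?(ltW rho0)//.
  by rewrite -invfM lef_pV2 ?posrE ?mulr_gt0//; move: acs; rewrite -/rho; lra.
apply: (@le_trans _ _ (2 * ((s - rho)^-1 ^+ n * (`|M| + 1)))).
  rewrite ler_pM2l// ler_wpM2l ?exprn_ge0 ?invr_ge0 ?(ltW srho)//.
  by have := ler_norm M; lra.
rewrite mulrCA -exprVn [leRHS]mulrCA [leRHS]mulrC ler_wpM2r//; lra.
Qed.

End UniqueContinuation.

(** * Functions vanishing on the real line *)

Section RealLine.
Context {R : realType} {W : lmodType R[i]} (nrm : W -> R).
Context (nrmD : forall u v, nrm (u + v) <= nrm u + nrm v).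
Context (nrmZ : forall k u, nrm (k *: u) = normc k * nrm u).
Implicit Types (F G : R[i] -> W) (z w a c : R[i]) (s : R).

(** Unique continuation with radii depending only on the disc where F is
    complex differentiable, and not on the size rc of the disc where F vanishes:
    this uniformity makes the set of zeros relatively closed. *)
Lemma zero_disc_spreads F z0 c r rc : 0 < r ->
  (forall w, normc (w - z0) < r -> cdifferentiable nrm F w) ->
  normc (c - z0) <= r / 16 -> 0 < rc ->
  (forall w, normc (w - c) < rc -> F w = 0) ->
  forall a, normc (a - z0) < r / 16 -> nrm (F a) = 0.
Proof.
move=> r0 Fd cz0 rc0 Fc0 a az0.
(* |a - c| < r / 8 < (7 r / 16) / 3, and the square of half side 7 r / 16 around
   a stays within distance 15 r / 16 of z0. *)
apply: (@unique_continuation _ _ _ nrmD nrmZ F a c (7 * (r / 16)) rc) => //.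
- by rewrite mulr_gt0 ?divr_gt0.
- have -> : a - c = (a - z0) - (c - z0) by ring.
  by apply: le_lt_trans (normc_triangle _ _) _; rewrite normc_opp; lra.
move=> w /in_centered_square[w1 w2]; apply: Fd.
have -> : w - z0 = (w - a) + (a - z0) by ring.
apply: le_lt_trans (normc_triangle _ _) _; have := normc_le_ReIm (w - a); lra.
Qed.

(** e = 1 and e = -1 select the closed upper and lower half planes. *)
Definition half_plane_cut (e : R) F z := if 0 <= e * Im z then F z else 0.

(** Only real z need an argument: the increments of F along the real line are
    zero, so its complex derivative there is 0, which is also the derivative of
    the constant 0 on the other side. *)
Lemma cdifferentiable_half_plane_cut (e : R) F z r :
  e != 0 -> 0 < r -> cdifferentiable nrm F z ->
  (forall w, normc (w - z) < r -> Im w = 0 -> F w = 0) ->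
  cdifferentiable nrm (half_plane_cut e F) z.
Proof.
move=> e0 r0 Fz F0.
have near0 w : normc (w - z) < `|Im z| ->
    (0 <= e * Im w) = (0 <= e * Im z).
  move=> wz; have := le_lt_trans (Im_le_normc _) wz; rewrite !ReImE.
  have [e1|e1|e1] := ltgtP e 0; last by rewrite e1 eqxx in e0.
    rewrite !nmulr_rge0//; case: (lerP (Im z) 0) => z1.
      by rewrite [`|Im z|]ler0_norm// ltr_norml => h; apply/idP; lra.
    by rewrite [`|Im z|]gtr0_norm// ltr_norml => h; apply/negbTE; rewrite -ltNge; lra.
  rewrite !pmulr_rge0//; case: (lerP 0 (Im z)) => z1.
    by rewrite [`|Im z|]ger0_norm// ltr_norml => h; apply/idP; lra.
  by rewrite [`|Im z|]ltr0_norm// ltr_norml => h; apply/negbTE; rewrite -ltNge; lra.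
have [z0|z0] := eqVneq (Im z) 0; last first.
  have Iz0 : 0 < `|Im z| by rewrite normr_gt0.
  have [ez|ez] := boolP (0 <= e * Im z).
    by apply: cdifferentiable_near Iz0 _ Fz => w wz; rewrite /half_plane_cut near0 ?ez.
  apply: cdifferentiable_near Iz0 _ (cdifferentiable_cst nrmZ 0 z) => w wz.
  by rewrite /half_plane_cut near0// (negbTE ez).
have Fz0 : F z = 0 by rewrite F0// subrr normc0.
have [d dP] := Fz.
have d0 : nrm d = 0.
  apply/eqP; rewrite eq_le (nrm_ge0 nrmD nrmZ) andbT.
  apply/ler_addgt0Pr => t t0; rewrite add0r.
  have [r' r'0 r'P] := dP t t0.
  pose h := Num.min r r' / 2.
  have h0 : 0 < h by rewrite divr_gt0// lt_min r0.
  have hr : h < Num.min r r' by rewrite /h ltr_pdivrMr// ltr_pMr ?ltr1n// lt_min r0.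
  move: hr; rewrite lt_min => /andP[hr hr'].
  have zh : z + h%:C%C - z = h%:C%C by rewrite addrAC subrr add0r.
  have nh : normc h%:C%C = h by rewrite normc_real gtr0_norm.
  have := r'P (z + h%:C%C); rewrite zh nh => /(_ hr').
  rewrite F0 ?zh ?nh//; last by rewrite !ReImE z0 /= addr0.
  by rewrite Fz0 subrr sub0r (nrmN nrmZ) nrmZ nh mulrC ler_pM2r.
exists 0 => t t0; have [r' r'0 r'P] := dP t t0; exists r' => // w /r'P.
rewrite /half_plane_cut Fz0 if_same scaler0 !subr0 => h.
case: ifP => _; last by rewrite (nrm0 nrmZ) mulr_ge0 ?normc_ge0 ?ltW.
rewrite -(subrK ((w - z) *: d) (F w)); apply: le_trans (nrmD _ _) _.
by rewrite nrmZ d0 mulr0 addr0.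
Qed.

(** Each of the two cuts of F vanishes on a disc in the opposite half plane,
    tangent to the real line at z0, hence near z0. *)
Lemma vanish_near_real F z0 r : 0 < r -> Im z0 = 0 ->
  (forall w, normc (w - z0) < r -> cdifferentiable nrm F w) ->
  (forall w, normc (w - z0) < r -> Im w = 0 -> F w = 0) ->
  forall a, normc (a - z0) < r / 16 -> nrm (F a) = 0.
Proof.
move=> r0 z00 Fd F0 a az0.
have cut0 (e : R) : `|e| = 1 -> nrm (half_plane_cut e F a) = 0.
  move=> e1; have ee : e * e = 1 by rewrite -expr2 -real_normK ?num_real// e1 expr1n.
  have e0 : e != 0 by rewrite -normr_eq0 e1 oner_eq0.
  have r16 : 0 < r / 16 by rewrite divr_gt0.
  have ne : normc (0 +i* (- e * (r / 16)))%C = r / 16.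
    by rewrite normc_imag normrM normrN e1 mul1r gtr0_norm.
  pose c := z0 + (0 +i* (- e * (r / 16)))%C.
  apply: (@zero_disc_spreads (half_plane_cut e F) z0 c r (r / 16) _ _ _ _ _ a) => //.
  - move=> w wz0; have w0 : 0 < r - normc (w - z0) by rewrite subr_gt0.
    apply: cdifferentiable_half_plane_cut e0 w0 (Fd w wz0) _ => v vw; apply: F0.
    have -> : v - z0 = (v - w) + (w - z0) by ring.
    by apply: le_lt_trans (normc_triangle _ _) _; lra.
  - by rewrite /c addrC addKr ne.
  move=> w wc; rewrite /half_plane_cut ifF//; apply/negbTE; rewrite -ltNge.
  have -> : e * Im w = e * Im (w - c) - e * e * (r / 16).
    by rewrite /c !ReImE z00 /=; ring.
  rewrite ee mul1r subr_lt0; apply: le_lt_trans (ler_norm _) _.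
  by rewrite normrM e1 mul1r; exact: le_lt_trans (Im_le_normc _) wc.
have := cut0 1 (normr1 _); have := cut0 (-1) _; rewrite normrN normr1 => /(_ erefl).
rewrite /half_plane_cut mulN1r mul1r.
by have [_ _ //|h] := lerP 0 (Im a); rewrite oppr_ge0 (ltW h).
Qed.

End RealLine.

(** * Invertible operators *)

Section CompAlgebra.
Context {R : realType} {P1 P2 P3 P4 : rightQuatBanachType R}.
Implicit Types (S : qbop P3 P4) (T : qbop P2 P3) (U : qbop P1 P2).

Lemma qbop_compA S T U : S \comp T \comp U = S \comp (T \comp U).
Proof. exact: qbop_eq. Qed.

Lemma qbop_comp1l T : qbop_id P3 \comp T = T.
Proof. exact: qbop_eq. Qed.

Lemma qbop_comp1r T : T \comp qbop_id P2 = T.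
Proof. exact: qbop_eq. Qed.

Lemma qbop_compZl k T U : (k *: T) \comp U = k *: (T \comp U).
Proof. exact: qbop_eq. Qed.

Lemma qbop_compZr k T U : T \comp (k *: U) = k *: (T \comp U).
Proof. by apply: qbop_eq => u /=; rewrite qbop_scale. Qed.

Lemma qbop_compDl T T' U : (T + T') \comp U = T \comp U + T' \comp U.
Proof. exact: qbop_eq. Qed.

Lemma qbop_compDr T U U' : T \comp (U + U') = T \comp U + T \comp U'.
Proof. by apply: qbop_eq => u /=; rewrite qbopD. Qed.

Lemma qbop_compNl T U : (- T) \comp U = - (T \comp U).
Proof. by rewrite -scaleN1r qbop_compZl scaleN1r. Qed.

Lemma qbop_compNr T U : T \comp (- U) = - (T \comp U).
Proof. by rewrite -scaleN1r qbop_compZr scaleN1r. Qed.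

Lemma qbop_comp_norm T U : `|T \comp U| <= `|T| * `|U|.
Proof.
apply: opnorm_le => u u1 /=; apply: le_trans (qbop_norm_le _ _) _.
by rewrite ler_wpM2l ?opnorm_ge0// opnorm_ub.
Qed.

End CompAlgebra.

Section Invertible.
Context {R : realType} {P : rightQuatBanachType R}.
Implicit Types S T H : qbop P P.

Lemma qbop_inv_unique T S : is_qbop_inv T S -> qbop_inv T = S.
Proof.
move=> [ST TS]; have ex : qbop_invertible T by exists S.
have [S'T _] : is_qbop_inv T (qbop_inv T) := xgetPex 0 ex.
by rewrite -[qbop_inv T]qbop_comp1r -TS -qbop_compA S'T qbop_comp1l.
Qed.

Lemma qbop_invK T : qbop_invertible T -> qbop_inv T \comp T = qbop_id P.
Proof. by move=> [S TS]; rewrite (qbop_inv_unique TS); exact: TS.1. Qed.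

Lemma qbop_Kinv T : qbop_invertible T -> T \comp qbop_inv T = qbop_id P.
Proof. by move=> [S TS]; rewrite (qbop_inv_unique TS); exact: TS.2. Qed.

Lemma qbop_invertible_comp S T : qbop_invertible S -> qbop_invertible T ->
  qbop_invertible (S \comp T).
Proof.
move=> [S' [S'S SS']] [T' [T'T TT']]; exists (T' \comp S'); split.
  by rewrite qbop_compA -(qbop_compA S') S'S qbop_comp1l.
by rewrite qbop_compA -(qbop_compA T) TT' qbop_comp1l.
Qed.

Lemma qbop_inv_sub T H : qbop_invertible T -> qbop_invertible (T + H) ->
  qbop_inv T - qbop_inv (T + H) = qbop_inv (T + H) \comp H \comp qbop_inv T.
Proof.
move=> Ti THi; apply/eqP; rewrite subr_eq; apply/eqP.
rewrite -[LHS]qbop_comp1l -(qbop_invK THi).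
by rewrite [_ \comp (T + H)]qbop_compDr qbop_compDl !qbop_compA qbop_Kinv// qbop_comp1r addrC.
Qed.

(** The equation v = u + T v is a contraction fixed point problem; uniqueness of
    its solution makes v a bounded right linear function of u. *)
Lemma qbop_neumann T : `|T| < 1 -> qbop_invertible (qbop_id P - T).
Proof.
move=> T1.
have solve (u : P) : exists v, v = u + T v.
  pose f (v : P) := u + T v.
  have ff : isFun _ _ [set: P] [set: P] f by constructor.
  pose F : {fun [set: P] >-> [set: P]} := HB.pack f ff.
  have [v _ vE] : exists2 v, [set: P] v & v = F v.
    apply: banach_fixed_point; [|exact: closedT|by exists 0].
    have q0 : 0 <= `|T| by [].
    exists (NngNum q0); split => // -[x y] _ /=.
    rewrite /F /f /= opprD addrACA subrr add0r -scaleN1r -qbop_scale -qbopD scaleN1r.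
    exact: qbop_norm_le.
  by exists v.
have fixle (u v : P) : v = u + T v -> `|v| <= (1 - `|T|)^-1 * `|u|.
  move=> vE; rewrite mulrC ler_pdivlMr ?subr_gt0//.
  have : `|v| <= `|u| + `|T| * `|v|.
    rewrite {1}vE; apply: le_trans (ler_normD _ _) _; rewrite lerD2l.
    exact: qbop_norm_le.
  by lra.
have fix0 (v v' u : P) : v = u + T v -> v' = u + T v' -> v = v'.
  move=> vE v'E; apply/eqP; rewrite -subr_eq0 -normr_le0.
  have := @fixle 0 (v - v'); rewrite normr0 mulr0; apply.
  rewrite add0r {1}vE {1}v'E -[in RHS](scaleN1r v') qbopD qbop_scale scaleN1r.
  by rewrite opprD addrACA subrr add0r.
have [S SP] := choice solve.
have SD u v : S (u + v) = S u + S v.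
  by apply: (fix0 _ _ (u + v)) => //; rewrite {1}SP {1}(SP v) qbopD addrACA.
have SZ u p : S (qrscale u p) = qrscale (S u) p.
  by apply: (fix0 _ _ (qrscale u p)) => //; rewrite {1}SP qrscaleDl qbopZr.
have SM : exists M : R, forall u, `|S u| <= M * `|u|.
  by exists (1 - `|T|)^-1 => u; apply: fixle.
exists (QBop SD SZ SM); split; apply: qbop_eq => u /=.
  apply: (fix0 _ _ (u - T u)); last by rewrite subrK.
  by have := SP (u + -1 *: T u); rewrite scaleN1r.
by rewrite scaleN1r {1}SP addrK.
Qed.

(** T + H = T (I + T^-1 H), and S' = S - S' H S bounds the norm of the inverse S'
    of T + H in terms of that of the inverse S of T. *)
Lemma qbop_invertible_perturb T H : qbop_invertible T ->
  `|qbop_inv T| * `|H| <= 2^-1 ->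
  qbop_invertible (T + H) /\ `|qbop_inv (T + H)| <= 2 * `|qbop_inv T|.
Proof.
move=> Ti TH; set S := qbop_inv T in TH *.
have TH1 : `|- (S \comp H)| < 1.
  by rewrite normrN; apply: le_lt_trans (qbop_comp_norm _ _) _; lra.
have THE : T + H = T \comp (qbop_id P - - (S \comp H)).
  by rewrite opprK qbop_compDr qbop_comp1r -qbop_compA qbop_Kinv// qbop_comp1l.
have THi : qbop_invertible (T + H).
  by rewrite THE; apply: qbop_invertible_comp => //; exact: qbop_neumann.
split => //; set S' := qbop_inv (T + H).
have S'E : S' = S - S' \comp H \comp S by rewrite -qbop_inv_sub// subKr.
have : `|S'| <= `|S| + `|S'| * `|H| * `|S|.
  rewrite {1}S'E; apply: le_trans (ler_normB _ _) _; rewrite lerD2l.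
  apply: le_trans (qbop_comp_norm _ _) _; rewrite ler_wpM2r//.
  exact: qbop_comp_norm.
have := normr_ge0 S'; nra.
Qed.

End Invertible.

(** * Differentials of operator-valued maps *)

(** Composition, inversion, the pencil and the numerator all have a remainder
    of second order with an explicit constant, so one criterion serves them all. *)
Lemma is_diff_quadratic (R : realType) (V W : normedModType R) (f df : V -> W)
    (x : V) (M K r : R) :
  linear df -> (forall h, `|df h| <= K * `|h|) -> 0 < r ->
  (forall h, `|h| < r -> `|f (h + x) - f x - df h| <= M * `|h| ^+ 2) ->
  is_diff x f df.
Proof.
move=> dfl dfK r0 fM.
pose dfL : {linear V -> W} := HB.pack df (GRing.isLinear.Build _ _ _ _ df dfl).
have dfc : continuous dfL.
  apply/bounded_linear_continuous/linear_boundedP.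
  exists K; split; first exact: num_real.
  move=> s Ks h; apply: le_trans (dfK h) _; rewrite ler_wpM2r//; exact: ltW.
have fo : f \o shift x = cst (f x) + dfL +o_ 0 id.
  apply/eqaddoP => e e0; near=> h.
  rewrite /= [X in `|X|](_ : _ = f (h + x) - f x - df h); last first.
    by rewrite !fctE /= opprD addrA.
  have hr : `|h| < r by near: h; apply/nbhs_norm0P; exists r.
  apply: le_trans (fM h hr) _; rewrite expr2 mulrA ler_wpM2r//.
  apply: (@le_trans _ _ ((`|M| + 1) * `|h|)).
    by rewrite ler_wpM2r//; have := ler_norm M; lra.
  have M0 : 0 < `|M| + 1 by have := normr_ge0 M; lra.
  rewrite mulrC -ler_pdivlMr//; near: h; apply/nbhs_norm0P.
  by exists (e / (`|M| + 1)); [rewrite /= divr_gt0 | move=> h /= /ltW].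
have dfE := diff_unique dfc fo.
apply: DiffDef; last exact: dfE.
by apply/diff_locallyP; rewrite dfE; split.
Unshelve. all: by end_near. Qed.

Section Differentials.
Context {R : realType} {P1 P2 P3 : rightQuatBanachType R}.

Lemma is_diff_qbop_comp (p : qbop P2 P3 * qbop P1 P2) :
  is_diff p (fun q => q.1 \comp q.2) (fun h => p.1 \comp h.2 + h.1 \comp p.2).
Proof.
apply: (@is_diff_quadratic _ _ _ _ _ _ 1 (`|p.1| + `|p.2|) 1) => //.
- move=> k [u1 u2] [v1 v2] /=.
  by rewrite qbop_compDr qbop_compDl qbop_compZr qbop_compZl scalerDr addrACA.
- move=> h; apply: le_trans (ler_normD _ _) _.
  have h1 : `|h.1| <= `|h| by rewrite num_le_max /= lexx.
  have h2 : `|h.2| <= `|h| by rewrite num_le_max /= lexx orbT.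
  rewrite mulrDl; apply: lerD; apply: le_trans (qbop_comp_norm _ _) _.
    by rewrite ler_wpM2l.
  by rewrite mulrC ler_wpM2l.
move=> h _; have h1 : `|h.1| <= `|h| by rewrite num_le_max /= lexx.
have h2 : `|h.2| <= `|h| by rewrite num_le_max /= lexx orbT.
rewrite /= qbop_compDr !qbop_compDl.
rewrite (_ : _ - _ = h.1 \comp h.2).
  apply: le_trans (qbop_comp_norm _ _) _.
  by rewrite mul1r expr2 ler_pM.
rewrite opprD !addrA [LHS](ACl (1*(2*6)*(3*7)*(4*5))) /=.
by rewrite !subrr !addr0.
Qed.

(** For S = T^-1 and S' = (T + H)^-1 the remainder S' - S + S H S equals
    S' H S H S. *)
Lemma is_diff_qbop_inv (T : qbop P1 P1) : qbop_invertible T ->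
  is_diff T (@qbop_inv R P1)
    (fun H => - (qbop_inv T \comp H \comp qbop_inv T)).
Proof.
move=> Ti; set S := qbop_inv T.
apply: (@is_diff_quadratic _ _ _ _ _ _ (2 * `|S| * (`|S| * `|S|)) (`|S| * `|S|)
   (2^-1 / (`|S| + 1))).
- move=> k u v.
  by rewrite qbop_compDr qbop_compDl qbop_compZr qbop_compZl opprD scalerN.
- move=> H; rewrite normrN; apply: le_trans (qbop_comp_norm _ _) _.
  by rewrite mulrAC ler_wpM2r//; exact: qbop_comp_norm.
- by rewrite divr_gt0// ltr_wpDl.
move=> H; rewrite ltr_pdivlMr ?ltr_wpDl// => HS.
have [THi S'S] : qbop_invertible (H + T) /\ `|qbop_inv (H + T)| <= 2 * `|S|.
  rewrite addrC; apply: qbop_invertible_perturb => //; rewrite -/S.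
  by have := normr_ge0 H; lra.
set S' := qbop_inv (H + T) in S'S *.
have S'E : S - S' = S' \comp H \comp S.
  by rewrite /S' addrC in THi *; exact: qbop_inv_sub.
have -> : S' - S - - (S \comp H \comp S) = S' \comp H \comp S \comp H \comp S.
  rewrite -S'E !qbop_compDl !qbop_compNl.
  by rewrite !qbop_compA -(qbop_compA S') -S'E opprK opprB addrC.
do !(apply: le_trans (qbop_comp_norm _ _) _).
rewrite (_ : 2 * _ * _ * _ = (2 * `|S|) * `|H| * `|S| * `|H| * `|S|); last by ring.
rewrite ler_wpM2r//; do !(apply: le_trans (qbop_comp_norm _ _) _; rewrite ler_wpM2r//).
Qed.

End Differentials.

(** * The S-resolvent and its Cauchy-Riemann equation *)

Section QuaternionFacts.
Context {R : realType}.
Implicit Types (p q h I : quat R).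

Definition qdot p q := qre p * qre q + qi p * qi q + qj p * qj q + qk p * qk q.

Lemma qnorm_sqr p : `|p| ^+ 2 = qdot p p.
Proof. by rewrite quat_normE /qnorm sqr_sqrtr /qdot -?expr2// !addr_ge0 ?sqr_ge0. Qed.

Lemma qdotDl p q r : qdot (p + q) r = qdot p r + qdot q r.
Proof. by rewrite /qdot /=; ring. Qed.
Lemma qdotZl k p r : qdot (k *: p) r = k * qdot p r.
Proof. by rewrite /qdot /=; ring. Qed.

Lemma qdot_le p q : `|qdot p q| <= `|p| * `|q|.
Proof.
rewrite -(@ler_pXn2r _ 2) ?nnegrE ?mulr_ge0// exprMn !qnorm_sqr real_normK ?num_real//.
rewrite -subr_ge0 /qdot.
case: p q => [a b c d] [a' b' c' d'] /=.
rewrite (_ : _ - _ = (a * b' - b * a') ^+ 2 + (a * c' - c * a') ^+ 2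
    + (a * d' - d * a') ^+ 2 + (b * c' - c * b') ^+ 2
    + (b * d' - d * b') ^+ 2 + (c * d' - d * c') ^+ 2); last by ring.
by rewrite !addr_ge0 ?sqr_ge0.
Qed.

Lemma qconj_norm p : `|qconj p| = `|p|.
Proof. by rewrite !quat_normE /qnorm /= !sqrrN. Qed.

Lemma qreal_norm (x : R) : `|qreal x| = `|x|.
Proof. by rewrite quat_normE /qnorm /= !expr0n /= !addr0 sqrtr_sqr. Qed.

Lemma qre_le_norm p : `|qre p| <= `|p|.
Proof.
have -> : qre p = qdot (qreal 1) p by rewrite /qdot /=; ring.
by apply: le_trans (qdot_le _ _) _; rewrite qreal_norm normr1 mul1r.
Qed.

Lemma imag_unit_sqr I : imag_unit I -> I * I = qreal (-1).
Proof.
move=> [I0 I1]; have : `|I| ^+ 2 = 1 by rewrite I1 expr1n.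
by rewrite qnorm_sqr /qdot I0 => h; apply: quat_eq; rewrite /= ?I0; lra.
Qed.

Lemma slice_ptE I (x y : R) : slice_pt I x y = x *: (1 : quat R) + y *: I.
Proof. by apply: quat_eq; rewrite /=; ring. Qed.

Lemma slice_pt_norm I (x y : R) : imag_unit I ->
  `|slice_pt I x y| ^+ 2 = x ^+ 2 + y ^+ 2.
Proof.
move=> [I0 I1]; have : `|I| ^+ 2 = 1 by rewrite I1 expr1n.
rewrite !qnorm_sqr slice_ptE => h.
by rewrite -[in RHS](mulr1 (y ^+ 2)) -[in RHS]h /qdot /= I0; ring.
Qed.

End QuaternionFacts.

Section LeftScalingAlgebra.
Context {R : realType} {P : rightQuatBanachType R} {Q : twoSidedQuatBanachType R}.
Implicit Types (p q : quat R) (T S : qbop P Q).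

Lemma qbop_lscaleDl p q T : (p + q) \ql T = p \ql T + q \ql T.
Proof. by apply: qbop_eq => u; exact: qlscaleDl. Qed.
Lemma qbop_lscaleDr p S T : p \ql (S + T) = p \ql S + p \ql T.
Proof. by apply: qbop_eq => u; exact: qlscaleDr. Qed.
Lemma qbop_lscaleA p q T : (p * q) \ql T = p \ql (q \ql T).
Proof. by apply: qbop_eq => u; exact: qlscaleA. Qed.
Lemma qbop_lscale_real (x : R) T : qreal x \ql T = x *: T.
Proof. by apply: qbop_eq => u; exact: qlscale_real. Qed.
Lemma qbop_lscaleZl (x : R) p T : (x *: p) \ql T = x *: (p \ql T).
Proof.
rewrite -!qbop_lscale_real -qbop_lscaleA; congr (_ \ql _).
by apply: quat_eq => /=; ring.
Qed.
Lemma qbop_lscaleZr (x : R) p T : p \ql (x *: T) = x *: (p \ql T).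
Proof.
rewrite -!qbop_lscale_real -!qbop_lscaleA; congr (_ \ql _).
by apply: quat_eq => /=; ring.
Qed.
Lemma qbop_lscaleNl p T : (- p) \ql T = - (p \ql T).
Proof. by rewrite -scaleN1r qbop_lscaleZl scaleN1r. Qed.
Lemma qbop_lscaleNr p T : p \ql (- T) = - (p \ql T).
Proof. by rewrite -scaleN1r qbop_lscaleZr scaleN1r. Qed.
Lemma qbop_lscale_comp p T (U : qbop P P) : (p \ql T) \comp U = p \ql (T \comp U).
Proof. exact: qbop_eq. Qed.

Lemma qbop_lscale_norm_le p T : `|p \ql T| <= `|p| * `|T|.
Proof.
apply: opnorm_le => u u1 /=; rewrite qlscale_norm ler_wpM2l//.
exact: opnorm_ub.
Qed.

End LeftScalingAlgebra.

Section Resolvent.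
Context {R : realType} {P : rightQuatBanachType R} {Q : twoSidedQuatBanachType R}.
Variables (A : qbop P P) (G : qbop P Q).
Implicit Types (p h I : quat R).

Definition dqpencil p h := (2 * qdot p h) *: (A \comp A) - (2 * qre h) *: A.

Lemma qpencil_increment p h :
  qpencil A (h + p) - qpencil A p = dqpencil p h + `|h| ^+ 2 *: (A \comp A).
Proof.
rewrite /qpencil /dqpencil; set B := A \comp A.
transitivity ((`|h + p| ^+ 2 - `|p| ^+ 2) *: B - (2 * qre (h + p) - 2 * qre p) *: A).
  rewrite !scalerBl opprD !opprB !addrA [LHS](ACl ((1*5)*3*6*4*2)) /=.
  by rewrite subrr add0r.
rewrite addrAC -scalerDl; congr (_ *: _ - _ *: _); last by rewrite /=; ring.
by rewrite !qnorm_sqr /qdot /=; ring.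
Qed.

Lemma is_diff_qpencil p : is_diff p (qpencil A) (dqpencil p).
Proof.
apply: (@is_diff_quadratic _ _ _ _ _ _ `|A \comp A|
  (2 * `|p| * `|A \comp A| + 2 * `|A|) 1) => //.
- move=> k u v; rewrite /dqpencil scalerBr !scalerA addrACA -opprD -!scalerDl.
  by congr (_ *: _ - _ *: _); rewrite /qdot /=; ring.
- move=> h; rewrite /dqpencil; apply: le_trans (ler_normB _ _) _; rewrite !normrZ !normr_nat.
  have := qdot_le p h; have := qre_le_norm h.
  have := normr_ge0 (A \comp A); have := normr_ge0 A; nra.
move=> h _; rewrite qpencil_increment addrAC subrr add0r normrZ ger0_norm ?sqr_ge0//.
by rewrite mulrC.
Qed.

Definition qnumer p : qbop P Q := G - qconj p \ql (G \comp A).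

Lemma is_diff_qnumer p : is_diff p qnumer (fun h => - (qconj h \ql (G \comp A))).
Proof.
apply: (@is_diff_quadratic _ _ _ _ _ _ 0 `|G \comp A| 1) => //.
- move=> k u v; rewrite scalerN -opprD -qbop_lscaleZl -qbop_lscaleDl.
  by congr (- (_ \ql _)); apply: quat_eq => /=; ring.
- move=> h; rewrite normrN mulrC -(qconj_norm h); exact: qbop_lscale_norm_le.
move=> h _; rewrite /qnumer mul0r.
rewrite (_ : qconj (h + p) = qconj h + qconj p); last by apply: quat_eq => /=; ring.
rewrite qbop_lscaleDl opprK opprB opprD !addrA [X in `|X|](ACl ((1*5)*(2*6)*(3*4))) /=.
by rewrite !subrr !addNr !addr0 normr0.
Qed.

Definition qresolvent p := qnumer p \comp qbop_inv (qpencil A p).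

Definition dqresolvent p h := let S := qbop_inv (qpencil A p) in
  qnumer p \comp (- (S \comp dqpencil p h \comp S)) - (qconj h \ql (G \comp A)) \comp S.

Lemma is_diff_qresolvent p : qbop_invertible (qpencil A p) ->
  is_diff p qresolvent (dqresolvent p).
Proof.
move=> pi.
have d1 := is_diff_qpencil p; have d2 := is_diff_qnumer p.
have d3 := is_diff_qbop_inv pi.
have d4 : is_diff p (qbop_inv (P := P) \o qpencil A) _ := is_diff_comp d1 d3.
have d5 := is_diff_pair d2 d4.
have d6 := is_diff_comp d5 (is_diff_qbop_comp (qnumer p, qbop_inv (qpencil A p))).
apply: (is_diff_eq d6); apply: funext => h /=.
by rewrite /dqresolvent qbop_compNl.
Qed.

Lemma qpencil_commute p : A \comp qpencil A p = qpencil A p \comp A.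
Proof.
rewrite /qpencil !qbop_compDr !qbop_compDl qbop_compNr qbop_compNl !qbop_compZr !qbop_compZl.
by rewrite qbop_compA qbop_comp1l qbop_comp1r.
Qed.

Lemma qpencil_inv_commute p : qbop_invertible (qpencil A p) ->
  A \comp qbop_inv (qpencil A p) = qbop_inv (qpencil A p) \comp A.
Proof.
move=> pi; set S := qbop_inv _.
rewrite -[LHS]qbop_comp1l -(qbop_invK pi) -/S.
by rewrite qbop_compA -(qbop_compA (qpencil A p)) -qpencil_commute
  (qbop_compA A) qbop_Kinv// qbop_comp1r.
Qed.

(** Multiplying on the right by L^2 and using that L commutes with A, the claim
    becomes N (d_x L) + I N (d_y L) = -2 G A L, where d_x L = 2 x A^2 - 2 A and
    d_y L = 2 y A^2.  The left side is 2 (p N A^2 - N A), in which the terms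
    with factor p or conj(p) combine to real multiples of G A^2 and G A^3. *)
Lemma dqresolvent_CR I (x y : R) : imag_unit I ->
  qbop_invertible (qpencil A (slice_pt I x y)) ->
  dqresolvent (slice_pt I x y) (qreal 1) + I \ql dqresolvent (slice_pt I x y) I = 0.
Proof.
move=> Iu pi; have I0 := Iu.1; have I1 := Iu.2; set p := slice_pt I x y in pi *.
have II : qdot I I = 1 by rewrite -qnorm_sqr I1 expr1n.
pose L := qpencil A p; pose S := qbop_inv L; pose B := A \comp A; pose N := qnumer p.
have dL1 : dqpencil p (qreal 1) = (2 * x) *: B - 2 *: A.
  by rewrite /dqpencil; congr (_ *: _ - _ *: _); rewrite /p ?slice_ptE /qdot /= ?I0; ring.
have dLI : dqpencil p I = (2 * y) *: B.
  rewrite /dqpencil I0 mulr0 scale0r subr0; congr (_ *: _).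
  by rewrite /p slice_ptE qdotDl !qdotZl II /qdot /= I0; ring.
have SA : A \comp S = S \comp A by exact: qpencil_inv_commute.
have SB : B \comp S = S \comp B by rewrite /B qbop_compA SA -!qbop_compA SA.
have key : N \comp dqpencil p (qreal 1) + I \ql (N \comp dqpencil p I) =
    (-2) *: (G \comp A \comp L).
  have p2 : p \ql (N \comp B) = p \ql (G \comp B) - (`|p| ^+ 2) *: (G \comp A \comp B).
    rewrite /N /qnumer qbop_compDl qbop_compNl qbop_lscaleDr qbop_lscaleNr.
    congr (_ - _); rewrite qbop_lscale_comp -qbop_lscaleA -qbop_lscale_real.
    by congr (_ \ql _); rewrite qnorm_sqr /qdot; apply: quat_eq => /=; ring.
  have c2 : N \comp A = G \comp A - qconj p \ql (G \comp B).
    by rewrite /N /qnumer qbop_compDl qbop_compNl qbop_lscale_comp qbop_compA.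
  have pc : p \ql (G \comp B) + qconj p \ql (G \comp B) = (2 * x) *: (G \comp B).
    rewrite -qbop_lscaleDl -qbop_lscale_real; congr (_ \ql _).
    by rewrite /p slice_ptE; apply: quat_eq; rewrite /= ?I0; ring.
  rewrite dL1 dLI qbop_compDr qbop_compNr !qbop_compZr addrAC.
  have -> : (2 * x) *: (N \comp B) + I \ql ((2 * y) *: (N \comp B)) = 2 *: (p \ql (N \comp B)).
    rewrite qbop_lscaleZr -qbop_lscale_real -!qbop_lscaleZl -qbop_lscaleDl.
    by congr (_ \ql _); rewrite /p slice_ptE; apply: quat_eq => /=; ring.
  rewrite p2 c2 -scalerBr scaleNr -scalerN; congr (2 *: _).
  rewrite /L /qpencil -/B !qbop_compDr qbop_comp1r qbop_compNr !qbop_compZr.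
  rewrite (qbop_compA G A A) -/B.
  have -> : (2 * qre p) *: (G \comp B) = p \ql (G \comp B) + qconj p \ql (G \comp B).
    by rewrite pc; congr (_ *: _); rewrite /p slice_ptE /= I0; ring.
  by rewrite !opprD !opprK !addrA [LHS](ACl (3*1*4*2)).
have SLS : L \comp (S \comp S) = S.
  by rewrite -qbop_compA qbop_Kinv// qbop_comp1l.
have dLS h : dqpencil p h \comp S = S \comp dqpencil p h.
  rewrite /dqpencil -/B qbop_compDl qbop_compDr qbop_compNl qbop_compNr.
  by rewrite !qbop_compZl !qbop_compZr SA SB.
have SdS h : N \comp (S \comp dqpencil p h \comp S) = N \comp dqpencil p h \comp (S \comp S).
  by rewrite -dLS !qbop_compA.
have GAS : (G \comp A \comp L) \comp (S \comp S) = G \comp A \comp S.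
  by rewrite qbop_compA SLS.
rewrite /dqresolvent -/L -/S -/N !qbop_compNr !SdS.
have -> : qconj (qreal 1 : quat R) = qreal 1 by apply: quat_eq => /=; ring.
have -> : qconj I = - I by apply: quat_eq; rewrite /= ?I0; ring.
rewrite qbop_lscaleNl qbop_compNl opprK qbop_lscaleDr qbop_lscaleNr.
rewrite qbop_lscale_real scale1r qbop_lscale_comp -qbop_lscaleA imag_unit_sqr//.
rewrite qbop_lscale_real scaleN1r addrACA -opprD -qbop_lscale_comp -qbop_compDl key.
by rewrite qbop_compZl GAS -opprD scaleNr opprK scaler_nat mulr2n subrr.
Qed.

End Resolvent.

(** * Slice functions as complex differentiable functions *)

Section SliceDerivative.
Context {R : realType} {P : rightQuatBanachType R} {Q : twoSidedQuatBanachType R}.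
Implicit Types (f : quat R -> qbop P Q) (I p : quat R).

Lemma derive1_line f (p v : quat R) (c : R -> quat R) (t : R) :
  (forall h : R, c (h + t) = h *: v + p) -> differentiable f p ->
  derive1 (f \o c) t = 'd f p v.
Proof.
move=> cE fd; rewrite -(deriveE v fd) /derive1 /derive.
have c0 : c t = p by rewrite -[t]add0r cE scale0r add0r.
set D := (fun h : R => _); set D' := (fun h : R => _).
by suff -> : D = D' by []; apply: funext => h; rewrite /D /D' /= cE c0.
Qed.

Lemma slice_CR_diff f I (x y : R) : differentiable f (slice_pt I x y) ->
  slice_CR f I x y =
  'd f (slice_pt I x y) (qreal 1) + I \ql 'd f (slice_pt I x y) I.
Proof.
move=> fd; rewrite /slice_CR.
rewrite (@derive1_line f (slice_pt I x y) (qreal 1) (fun s => slice_pt I s y) x) => //;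
  last first.
  by move=> h; rewrite !slice_ptE; apply: quat_eq => /=; ring.
rewrite (@derive1_line f (slice_pt I x y) I (fun t => slice_pt I x t) y) => //.
by move=> h; rewrite !slice_ptE; apply: quat_eq => /=; ring.
Qed.

End SliceDerivative.

Section SliceModule.
Context {R : realType} {P : rightQuatBanachType R} {Q : twoSidedQuatBanachType R}.

Definition slice_of (I : quat R) (z : R[i]) : quat R :=
  slice_pt I (Re z) (Im z).

(** Operators as a complex vector space, x + i y acting as left multiplication by
    x + I y.  The proof that I is an imaginary unit is a parameter because the
    module axioms depend on I^2 = -1. *)
Definition slice_module (I : quat R) (Iu : imag_unit I) : Type := qbop P Q.

Variables (I : quat R) (Iu : imag_unit I).

Lemma slice_of_add z w : slice_of I (z + w) = slice_of I z + slice_of I w.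
Proof. by rewrite /slice_of !ReImE !slice_ptE; apply: quat_eq => /=; ring. Qed.

Lemma slice_of_mul z w : slice_of I (z * w) = slice_of I z * slice_of I w.
Proof.
have I0 := Iu.1; have I1 : qdot I I = 1 by rewrite -qnorm_sqr Iu.2 expr1n.
have h : Im z * Im w * qdot I I = Im z * Im w.
  by rewrite I1 mulr1.
rewrite /qdot I0 in h; rewrite /slice_of !ReImE !slice_ptE.
by apply: quat_eq; rewrite /= ?I0; lra.
Qed.

Lemma slice_of_norm z : `|slice_of I z| = normc z.
Proof.
apply/eqP; rewrite -(eqrXn2 (ltn0Sn 1)) ?normc_ge0// slice_pt_norm// normc_sqrtE.
by rewrite sqr_sqrtr// addr_ge0 ?sqr_ge0.
Qed.

HB.instance Definition _ := GRing.Zmodule.on (slice_module Iu).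

Definition slice_scale (z : R[i]) (T : slice_module Iu) : slice_module Iu :=
  slice_of I z \ql (T : qbop P Q).

Fact slice_scaleA z w T : slice_scale z (slice_scale w T) = slice_scale (z * w) T.
Proof. by rewrite /slice_scale slice_of_mul qbop_lscaleA. Qed.
Fact slice_scale1 : left_id 1 slice_scale.
Proof.
move=> T; rewrite /slice_scale (_ : slice_of I 1 = qreal 1) ?qbop_lscale_real ?scale1r//.
by rewrite /slice_of /=; apply: quat_eq => /=; ring.
Qed.
Fact slice_scaleDr : right_distributive slice_scale +%R.
Proof. by move=> z S T; exact: qbop_lscaleDr. Qed.
Fact slice_scaleDl T : {morph slice_scale^~ T : z w / z + w}.
Proof. by move=> z w; rewrite /slice_scale slice_of_add qbop_lscaleDl. Qed.

HB.instance Definition _ := GRing.Zmodule_isLmodule.Build R[i] (slice_module Iu)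
  slice_scaleA slice_scale1 slice_scaleDr slice_scaleDl.

Definition slice_nrm (T : slice_module Iu) : R := `|T : qbop P Q|.

Lemma slice_nrmD S T : slice_nrm (S + T) <= slice_nrm S + slice_nrm T.
Proof. exact: ler_normD. Qed.

(** The bound [qbop_lscale_norm_le] is one inequality; the same bound for z^-1,
    applied to z *: T, is the other. *)
Lemma slice_nrmZ z T : slice_nrm (z *: T) = normc z * slice_nrm T.
Proof.
have le w (U : slice_module Iu) : slice_nrm (w *: U) <= normc w * slice_nrm U.
  by rewrite -slice_of_norm; exact: qbop_lscale_norm_le.
apply/eqP; rewrite eq_le le /=.
have [->|z0] := eqVneq z 0; first by rewrite normc0 mul0r; exact: normr_ge0.
have := le z^-1 (z *: T); rewrite scalerA mulVf// scale1r normcV.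
by rewrite ler_pdivlMl// normc_gt0.
Qed.

(** The Cauchy-Riemann equation says that the real differential maps I to I times
    the image of 1, hence is complex linear on the slice. *)
Lemma slice_cdifferentiable (f : quat R -> qbop P Q) (z : R[i]) :
  differentiable f (slice_of I z) ->
  slice_CR f I (Re z) (Im z) = 0 ->
  cdifferentiable slice_nrm (fun w => f (slice_of I w) : slice_module Iu) z.
Proof.
move=> fd; rewrite slice_CR_diff// -/(slice_of I z); set p := slice_of I z in fd *.
move=> CR; have dI : 'd f p I = I \ql 'd f p (qreal 1).
  apply/eqP; rewrite -subr_eq0; apply/eqP.
  have := congr1 (fun T => - (I \ql T)) CR.
  rewrite qbop_lscaleDr -qbop_lscaleA imag_unit_sqr// qbop_lscale_real scaleN1r.
  have I00 : I \ql (0 : qbop P Q) = 0.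
    by rewrite -(scale0r (0 : qbop P Q)) qbop_lscaleZr !scale0r.
  by rewrite opprB I00 oppr0.
exists ('d f p (qreal 1)) => e e0.
have /eqaddoP/(_ e e0) := diff_locally fd.
move=> /nbhs_norm0P[r /= r0 rP]; exists r => // w wr.
have wz : slice_of I w = slice_of I (w - z) + p by rewrite -slice_of_add subrK.
have wr' : `|slice_of I (w - z)| < r by rewrite slice_of_norm.
have := rP _ wr'; rewrite slice_of_norm.
rewrite !fctE /= opprD addrA -wz /slice_nrm.
suff -> : 'd f p (slice_of I (w - z)) = slice_scale (w - z) ('d f p (qreal 1)) by [].
rewrite /slice_scale /slice_of slice_ptE linearD !linearZ dI.
by rewrite qbop_lscaleDl !qbop_lscaleZl -[1 \ql _]/(qreal 1 \ql _) qbop_lscale_real scale1r.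
Qed.

End SliceModule.

(** * The identity theorem on a slice *)

Section SliceIdentity.
Context {R : realType} {P : rightQuatBanachType R} {Q : twoSidedQuatBanachType R}.
Implicit Types (f g h : quat R -> qbop P Q) (I p : quat R) (V : set (quat R)).

Lemma slice_of_real I (x : R) : slice_of I x%:C%C = qreal x.
Proof. by rewrite /slice_of slice_ptE; apply: quat_eq => /=; ring. Qed.

Lemma slice_of_dist I (Iu : imag_unit I) z w :
  `|slice_of I z - slice_of I w| = normc (z - w).
Proof.
rewrite -(slice_of_norm Iu) !/(slice_of I _) !slice_ptE; congr (`|_|).
by rewrite !ReImE; apply: quat_eq => /=; ring.
Qed.

Lemma slice_planeP I p : slice_plane I p <-> exists z, p = slice_of I z.
Proof.
split=> [[x [y ->]]|[z ->]]; first by exists (x +i* y)%C.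
by exists (Re z), (Im z).
Qed.

Lemma mem_some_slice p : exists2 I, imag_unit I & slice_plane I p.
Proof.
pose v : quat R := Quat 0 (qi p) (qj p) (qk p).
have pE : p = qreal (qre p) + v by apply: quat_eq; rewrite /= ?addr0 ?add0r.
have [v0|v0] := eqVneq v 0.
  exists (Quat 0 1 0 0).
    by split => //; rewrite quat_normE /qnorm /= !expr0n expr1n /= add0r !addr0 sqrtr1.
  by exists (qre p), 0; rewrite {1}pE v0; apply: quat_eq => /=; ring.
exists (`|v|^-1 *: v).
  split; first by rewrite /= mulr0.
  by rewrite normrZ normfV normr_id mulVf// normr_eq0.
exists (qre p), `|v|; rewrite slice_ptE scalerA divff ?normr_eq0// scale1r {1}pE.
by congr (_ + _); apply: quat_eq => /=; ring.
Qed.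

(** The points of the slice near which g vanishes form a set that is open by
    definition, closed by [zero_disc_spreads], and nonempty by
    [vanish_near_real].  Since g is known to vanish at nonzero real points
    only, the last step takes place in a disc around one of them that avoids 0. *)
Lemma slice_identity I V g (x0 : R) (Iu : imag_unit I) :
  open V -> connected (V `&` slice_plane I) ->
  (forall z, V (slice_of I z) ->
     cdifferentiable (@slice_nrm _ _ _ _ Iu) (fun w => g (slice_of I w)) z) ->
  V (qreal x0) -> (forall x, x != 0 -> V (qreal x) -> g (qreal x) = 0) ->
  forall p, V p -> slice_plane I p -> g p = 0.
Proof.
move=> oV cV gd Vx0 g0 p Vp Ip.
set nrm := @slice_nrm _ _ _ _ Iu in gd.
pose F (w : R[i]) : slice_module Iu := g (slice_of I w).
have nD : forall u v, nrm (u + v) <= nrm u + nrm v := @slice_nrmD _ _ _ _ Iu.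
have nZ : forall k u, nrm (k *: u) = normc k * nrm u := @slice_nrmZ _ _ _ _ Iu.
have F0 w : nrm (F w) = 0 -> F w = 0 by move/normr0_eq0.
have discV z : V (slice_of I z) -> exists2 r, 0 < r &
    forall w, normc (w - z) < r -> V (slice_of I w).
  move=> Vz; have : nbhs (slice_of I z) V by apply: open_nbhs_nbhs.
  move=> /nbhs_normP[r /= r0 rV]; exists r => // w wz; apply: rV.
  by rewrite /ball_ /= (slice_of_dist Iu) normc_dist.
pose O : set (quat R) := [set q | exists2 r, 0 < r &
  forall w, `|slice_of I w - q| < r -> F w = 0].
suff BA : V `&` slice_plane I `&` O = V `&` slice_plane I.
  have : (V `&` slice_plane I) p by [].
  rewrite -BA => -[_ [r r0 rO]]; move/slice_planeP: Ip rO => [z ->] rO.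
  by apply: rO; rewrite subrr normr0.
apply: cV.
- have [x1 x10 Vx1] : exists2 x1 : R, x1 != 0 & V (qreal x1).
    have [x00|] := eqVneq x0 0; last by exists x0.
    have [r r0 rV] : exists2 r, 0 < r & forall w, normc (w - x0%:C%C) < r -> V (slice_of I w).
      by apply: discV; rewrite slice_of_real.
    exists (r / 2); first by rewrite gt_eqF// divr_gt0.
    rewrite -(slice_of_real I); apply: rV.
    by rewrite x00 subr0 normc_real gtr0_norm ?divr_gt0// ltr_pdivrMr// ltr_pMr ?ltr1n.
  have [r r0 rV] : exists2 r, 0 < r & forall w, normc (w - x1%:C%C) < r -> V (slice_of I w).
    by apply: discV; rewrite slice_of_real.
  have r'0 : 0 < Num.min r `|x1| by rewrite lt_min r0 normr_gt0.
  exists (qreal x1); split.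
    by split => //; apply/slice_planeP; exists x1%:C%C; rewrite slice_of_real.
  exists (Num.min r `|x1| / 16); first by rewrite divr_gt0.
  move=> a; rewrite -(slice_of_real I) (slice_of_dist Iu) => ha; apply: F0.
  apply: (vanish_near_real nD nZ r'0 _ _ _ ha) => //.
    by move=> w; rewrite lt_min => /andP[wr _]; apply: gd; exact: rV.
  move=> w; rewrite lt_min => /andP[/rV Vw wx1] w0.
  have wE : w = (Re w)%:C%C by apply: complex_ext.
  rewrite wE slice_of_real in Vw; rewrite /F wE slice_of_real; apply: g0 => //.
  apply/eqP => rw0; move: wx1; rewrite wE rw0 sub0r normc_opp normc_real.
  by rewrite ltxx.
- exists O => //; rewrite openE => q [r r0 rO]; apply/nbhs_normP.
  exists (r / 2); first by rewrite /= divr_gt0.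
  move=> q' /= qq'; exists (r / 2); first by rewrite divr_gt0.
  move=> w wq'; apply: rO; rewrite -(subrK q' (slice_of I w)) -addrA.
  apply: le_lt_trans (ler_normD _ _) _; rewrite [`|q' - q|]distrC.
  by move: qq' wq'; lra.
exists (closure (V `&` slice_plane I `&` O)); first exact: closed_closure.
apply/seteqP; split => [q qB|q [[Vq Iq] qB]].
  by split; [case: qB | exact: subset_closure].
split => //; move/slice_planeP: Iq Vq qB => [z ->] Vz zB.
have [r r0 rV] := discV z Vz; have r16 : 0 < r / 16 by rewrite divr_gt0.
have : nbhs (slice_of I z) (ball (slice_of I z) (r / 16)) by exact: nbhsx_ballx.
move=> /zB[q' [[[Vq /slice_planeP[c qE]] [rc rc0 rcO]]]].
rewrite -ball_normE /= {}qE (slice_of_dist Iu) normc_dist in Vq rcO * => cz.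
exists (r / 16) => // a; rewrite (slice_of_dist Iu) => az; apply: F0.
apply: (zero_disc_spreads nD nZ r0 _ (ltW cz) rc0 _ az).
  by move=> w wz; apply: gd; exact: rV.
by move=> w wc; apply: rcO; rewrite (slice_of_dist Iu).
Qed.

End SliceIdentity.

(** * The slice hyperholomorphic extension *)

Section Main.
Context {R : realType} {P : rightQuatBanachType R} {Q : twoSidedQuatBanachType R}.
Variables (A : qbop P P) (G : qbop P Q).

(** The inverse S of k M^2 gives the left inverse k S M and the right inverse k M S. *)
Lemma qbop_invertible_root (M : qbop P P) (k : R) :
  qbop_invertible (k *: (M \comp M)) -> qbop_invertible M.
Proof.
move=> [S [SM MS]].
have l : (k *: (S \comp M)) \comp M = qbop_id P by rewrite qbop_compZl qbop_compA -qbop_compZr.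
have r : M \comp (k *: (M \comp S)) = qbop_id P by rewrite qbop_compZr -qbop_compA -qbop_compZl.
have lr : k *: (S \comp M) = k *: (M \comp S).
  by rewrite -[LHS]qbop_comp1r -r -qbop_compA l qbop_comp1l.
by exists (k *: (S \comp M)); split => //; rewrite lr.
Qed.

Lemma qpencil_real (x : R) :
  qpencil A (qreal x) = (qbop_id P - x *: A) \comp (qbop_id P - x *: A).
Proof.
rewrite qbop_compDr qbop_comp1r qbop_compNr qbop_compDl qbop_comp1l.
rewrite qbop_compZr qbop_compNl qbop_compZl scalerN scalerA.
rewrite opprB !addrA /qpencil.
rewrite qreal_norm real_normK ?num_real// -expr2 mulr_natl mulr2n scalerDl opprD.
by rewrite !addrA [LHS](ACl (1*2*4*3)).
Qed.

Lemma spectral_pencilE (x : R) : x != 0 ->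
  A \comp A - (2 * qre (qreal x^-1)) *: A + (`|qreal x^-1| ^+ 2) *: qbop_id P =
  x^-1 ^+ 2 *: qpencil A (qreal x).
Proof.
move=> x0; rewrite /qpencil !scalerDr scalerN !scalerA !qreal_norm !real_normK ?num_real//.
rewrite -exprMn mulVf// expr1n scale1r /=.
rewrite (_ : x^-1 ^+ 2 * (2 * x) = 2 * x^-1); last by field.
by rewrite [RHS](ACl (3*2*1)).
Qed.

Definition real_domain : set R := [set x | x != 0 /\ S_resolvent_set A (qreal x^-1)].

(** By [spectral_pencilE], the operator whose invertibility decides whether 1/x
    lies in the resolvent set is x^-2 times the pencil at x. *)
Lemma real_domainP (x : R) : x != 0 -> real_domain x <-> qbop_invertible (qpencil A (qreal x)).
Proof.
move=> x0; have xx : x^-1 ^+ 2 != 0 by rewrite expf_neq0// invr_eq0.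
have scale (k : R) (T : qbop P P) : k != 0 -> qbop_invertible T -> qbop_invertible (k *: T).
  move=> k0 [S [ST TS]]; exists (k^-1 *: S).
  by split; rewrite qbop_compZl qbop_compZr scalerA ?mulVf ?mulfV// scale1r.
rewrite /real_domain /S_resolvent_set /S_spectrum /=; rewrite spectral_pencilE//.
split=> [[_ /contrapT h]|h]; last by split => //; apply; exact: scale.
have := @scale (x ^+ 2) _ (expf_neq0 _ x0) h.
by rewrite scalerA -exprMn mulfV// expr1n scale1r.
Qed.

Lemma qpencil_real_invertible (x : R) :
  qbop_invertible (qpencil A (qreal x)) <-> qbop_invertible (qbop_id P - x *: A).
Proof.
rewrite qpencil_real; split=> [h|h]; last exact: qbop_invertible_comp.
by apply: (@qbop_invertible_root _ 1); rewrite scale1r.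
Qed.

Lemma qresolvent_real (x : R) : qbop_invertible (qbop_id P - x *: A) ->
  qresolvent A G (qreal x) = G \comp qbop_inv (qbop_id P - x *: A).
Proof.
move=> Mi; rewrite /qresolvent qpencil_real.
set M := qbop_id P - x *: A in Mi *.
have -> : qbop_inv (M \comp M) = qbop_inv M \comp qbop_inv M.
  apply: qbop_inv_unique; split.
    by rewrite qbop_compA -(qbop_compA _ M) qbop_invK// qbop_comp1l qbop_invK.
  by rewrite qbop_compA -(qbop_compA M (qbop_inv M)) qbop_Kinv// qbop_comp1l qbop_Kinv.
have -> : qnumer A G (qreal x) = G \comp M.
  rewrite /qnumer /M qbop_compDr qbop_comp1r qbop_compNr qbop_compZr.
  rewrite -qbop_lscale_real; congr (_ - _ \ql _); apply: quat_eq => /=; ring.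
by rewrite !qbop_compA -(qbop_compA M) qbop_Kinv// qbop_comp1l.
Qed.

Lemma open_qpencil_invertible : open [set p : quat R | qbop_invertible (qpencil A p)].
Proof.
rewrite openE => p /= pi; rewrite /interior.
have pc : {for p, continuous (qpencil A)}.
  by apply: differentiable_continuous; exact: (@ex_diff _ _ _ _ _ _ _ (is_diff_qpencil A p)).
set S := qbop_inv (qpencil A p).
have S1 : 0 < `|S| + 1 by have := normr_ge0 S; lra.
have := pc; move/cvgrPdist_lt => /(_ (2^-1 / (`|S| + 1))).
rewrite divr_gt0// => /(_ isT); apply: filterS => q /= h.
have -> : qpencil A q = qpencil A p + (qpencil A q - qpencil A p) by rewrite addrC subrK.
apply: (qbop_invertible_perturb pi _).1; rewrite -/S distrC.
by move: h; rewrite ltr_pdivlMr//; have := normr_ge0 (qpencil A p - qpencil A q); lra.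
Qed.

Lemma slice_CR_qresolvent I (x y : R) : imag_unit I ->
  qbop_invertible (qpencil A (slice_pt I x y)) ->
  slice_CR (qresolvent A G) I x y = 0.
Proof.
move=> Iu pi; have d := is_diff_qresolvent G pi.
rewrite slice_CR_diff; last exact: (@ex_diff _ _ _ _ _ _ _ d).
by rewrite !(@diff_val _ _ _ _ _ _ _ d); exact: dqresolvent_CR.
Qed.

End Main.

Theorem proposition3p24 (R : realType) (P : rightQuatBanachType R)
    (Q : twoSidedQuatBanachType R) (A : qbop P P) (G : qbop P Q) :
  let D := [set x : R | x != 0 /\ S_resolvent_set A (qreal x^-1)] in
  (forall x, D x -> qbop_invertible (qbop_id P - x *: A)) /\
  is_the_slice_extension D
    (fun x => G \comp qbop_inv (qbop_id P - x *: A))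
    [set p : quat R | qbop_invertible (qpencil A p)]
    (fun p => (G - qconj p \ql (G \comp A)) \comp qbop_inv (qpencil A p)).
Proof.
move=> D.
have DP x : x != 0 -> D x <-> qbop_invertible (qpencil A (qreal x)).
  by move=> ?; exact: real_domainP.
have Dinv x : D x -> qbop_invertible (qbop_id P - x *: A).
  by move=> Dx; apply/qpencil_real_invertible/DP => //; case: Dx.
split => //; rewrite -/(qresolvent A G).
have fd p : qbop_invertible (qpencil A p) -> differentiable (qresolvent A G) p.
  by move=> pi; exact: (@ex_diff _ _ _ _ _ _ _ (is_diff_qresolvent G pi)).
have fCR := @slice_CR_qresolvent R P Q A G.
split.
- by move=> x Dx; apply/DP => //; case: Dx.
- split; last by move=> x Dx _; exact/qresolvent_real/Dinv.
  by split; [exact: open_qpencil_invertible | exact: fd | move=> I x y; exact: fCR].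
move=> V h [oV [q [Vq [x0 _ x0q]]] cV] VU [[_ hd hCR] hg] p Vp.
have [I Iu Ip] := mem_some_slice p.
apply/eqP; rewrite -subr_eq0; apply/eqP.
apply: (@slice_identity _ _ _ I V (fun p => h p - qresolvent A G p) x0 Iu) => //.
- exact: cV.
- move=> z Vz; apply: (cdifferentiableB (@slice_nrmD _ _ _ _ _) (@slice_nrmZ _ _ _ _ _)).
    by apply: slice_cdifferentiable; [exact: hd | exact: hCR].
  by apply: slice_cdifferentiable; [exact/fd/VU | exact/fCR/VU].
- by rewrite x0q.
move=> x xn0 Vx; have Dx : D x by apply/DP => //; exact: VU.
by rewrite hg// qresolvent_real ?subrr//; exact: Dinv.
Qed.
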